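(* Let $\mathfrak{g}$ be a finite-dimensional Lie algebra over an algebraically closed field $K$ of characteristic zero whose solvable radical is abelian. Then $\mathrm{AID}(\mathfrak{g})=\mathrm{Inn}(\mathfrak{g})$.
   Context: For a finite-dimensional Lie algebra $\mathfrak{g}$ over a field $K$, let $\mathrm{Der}(\mathfrak{g})$ be its Lie algebra of derivations and $\mathrm{Inn}(\mathfrak{g})=\{\mathrm{ad}(x)\mid x\in\mathfrak{g}\}$ the inner derivations. A derivation $D\in\mathrm{Der}(\mathfrak{g})$ is called almost inner if $D(x)\in[\mathfrak{g},x]=\{[y,x]\mid y\in\mathfrak{g}\}$ for all $x\in\mathfrak{g}$. The space of almost inner derivations is denoted $\mathrm{AID}(\mathfrak{g})$. *)

(* Defs.v *)
From HB Require Import structures.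
From mathcomp Require Import all_boot all_order all_algebra.
From mathcomp Require Import boolp classical_sets.

Set Implicit Arguments.
Unset Strict Implicit.
Unset Printing Implicit Defensive.

Import GRing.Theory.
Local Open Scope ring_scope.

HB.mixin Record isLieAlgebra (K : fieldType) (g : Type) of Vector K g := {
  bracket : g -> g -> g;
  bracket_linearl : forall (a : K) (x y z : g),
    bracket (a *: x + y) z = a *: bracket x z + bracket y z;
  bracket_linearr : forall (a : K) (x y z : g),
    bracket x (a *: y + z) = a *: bracket x y + bracket x z;
  bracketxx : forall x : g, bracket x x = 0;
  jacobi : forall x y z : g,
    bracket x (bracket y z) + bracket y (bracket z x)
      + bracket z (bracket x y) = 0
}.

#[short(type="lieAlgType")]
HB.structure Definition LieAlgebra (K : fieldType) :=
  {g of isLieAlgebra K g & Vector K g}.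

Notation "[ 'lie' x , y ]" := (bracket x y)
  (at level 0, x at level 99, y at level 99, format "[ 'lie'  x ,  y ]")
  : ring_scope.

Section LieAlgebraTheory.

Context {K : fieldType} {g : lieAlgType K}.
Implicit Types (x y z : g) (U V W I J : {vspace g}).

HB.instance Definition _ x :=
  GRing.isLinear.Build K g g _ (@bracket K g x)
    (fun a y z => bracket_linearr a x y z).

Definition ad x : 'End(g) := linfun (bracket x).

Lemma adE x y : ad x y = [lie x, y].
Proof. by rewrite lfunE. Qed.

Definition is_derivation (D : 'End(g)) : Prop :=
  forall x y, D [lie x, y] = [lie D x, y] + [lie x, D y].

(* The span of all brackets of an element of U with an element of V; by
   bilinearity basis vectors suffice, see [brackv_subP] *)
Definition brackv U V : {vspace g} :=
  <<[seq [lie x, y] | x <- vbasis U, y <- vbasis V]>>%VS.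

Definition lie_ideal I : Prop := forall x y, y \in I -> [lie x, y] \in I.

Definition lie_abelian U : Prop := brackv U U = 0%VS.

Fixpoint derived_series U (n : nat) : {vspace g} :=
  if n is m.+1 then brackv (derived_series U m) (derived_series U m) else U.

Definition lie_solvable U : Prop := exists n, derived_series U n = 0%VS.

Definition is_radical U : Prop :=
  [/\ lie_ideal U, lie_solvable U &
      forall I, lie_ideal I -> lie_solvable I -> (I <= U)%VS].

Lemma brack_suml (J : Type) (r : seq J) (F : J -> g) y :
  [lie \sum_(i <- r) F i, y] = \sum_(i <- r) [lie F i, y].
Proof.
have b0 : [lie 0, y] = 0.
  by have := bracket_linearl (-1) 0 0 y; rewrite scaleN1r oppr0 addr0 scaleN1r addNr.
elim: r => [|i r IHr]; first by rewrite !big_nil.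
by rewrite !big_cons -[F i]scale1r bracket_linearl !scale1r IHr.
Qed.

Lemma brackZl a x y : [lie a *: x, y] = a *: [lie x, y].
Proof.
have b0 : [lie 0, y] = 0 by have := @brack_suml 'I_0 [::] (fun=> 0) y; rewrite !big_nil.
by rewrite -[a *: x]addr0 bracket_linearl b0 addr0.
Qed.

Lemma brackv_subP U V W :
  (brackv U V <= W)%VS <->
  (forall x y, x \in U -> y \in V -> [lie x, y] \in W).
Proof.
split=> [sUVW x y xU yV|sUVW].
  rewrite (coord_vbasis xU) (coord_vbasis yV) brack_suml memv_suml// => i _.
  rewrite linear_sum /= memv_suml// => j _.
  rewrite brackZl linearZ /= !memvZ// (subvP sUVW)// memv_span//.
  by apply: allpairs_f; apply: mem_nth; rewrite size_tuple.
apply/span_subvP => z /allpairsP[[x y] /= [xU yV ->]].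
by apply: sUVW; apply: vbasis_mem.
Qed.

Lemma memv_brack U V x y :
  x \in U -> y \in V -> [lie x, y] \in brackv U V.
Proof. by have [/(_ (subvv _)) + _] := brackv_subP U V (brackv U V); apply. Qed.

Lemma brackC x y : [lie x, y] = - [lie y, x].
Proof.
apply/eqP; rewrite -addr_eq0; apply/eqP.
have := bracketxx (x + y).
by rewrite -[x in bracket (x + _)]scale1r bracket_linearl scale1r !linearD /=
  !bracketxx add0r addr0.
Qed.

Lemma derived_seriesS U V n :
  (U <= V)%VS -> (derived_series U n <= derived_series V n)%VS.
Proof.
move=> sUV; elim: n => //= n /subvP IHn.
by apply/brackv_subP => x y /IHn xV /IHn yV; apply: memv_brack.
Qed.

Lemma derived_series_add U m n :
  derived_series U (m + n) = derived_series (derived_series U m) n.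
Proof. by elim: n => [|n IHn]; rewrite ?addn0 // addnS /= IHn. Qed.

Lemma lie_idealD I J : lie_ideal I -> lie_ideal J -> lie_ideal (I + J)%VS.
Proof.
move=> iI iJ x y /memv_addP[u uI [v vJ ->]].
by rewrite linearD memv_add// (iI, iJ).
Qed.

Lemma lie_solvableD I J : lie_ideal J ->
  lie_solvable I -> lie_solvable J -> lie_solvable (I + J)%VS.
Proof.
move=> iJ [m Im] [n Jn]; exists (m + n)%N.
have sIJ k : (derived_series (I + J) k <= derived_series I k + J)%VS.
  elim: k => //= k /subvP IHk.
  apply/brackv_subP => x y /IHk/memv_addP[u uI [v vJ ->]].
  move=> /IHk/memv_addP[u' uI' [v' vJ' ->]].
  rewrite -[u]scale1r bracket_linearl scale1r linearD /= -addrA memv_add//.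
    exact: memv_brack.
  by apply: memvD; [exact: iJ | rewrite brackC memvN; exact: iJ].
apply/eqP; rewrite -subv0 derived_series_add -Jn derived_seriesS//.
by have := sIJ m; rewrite Im add0v.
Qed.

Lemma radical_exists : exists R, is_radical R.
Proof.
pose P (n : nat) :=
  `[< exists I, [/\ lie_ideal I, lie_solvable I & \dim I = n] >].
have exP : exists n, P n.
  exists 0%N; apply/asboolP; exists 0%VS; split; last by rewrite dimv0.
    by move=> x y; rewrite !memv0 => /eqP ->; rewrite linear0.
  by exists 0%N.
have ubP n : P n -> (n <= \dim {:g})%N.
  by move=> /asboolP[I [_ _ <-]]; rewrite dimvS ?subvf.
case: (ex_maxnP exP ubP) => n /asboolP[R [iR sR dR]] maxR.
exists R; split=> // I iI sI.
have : (\dim (I + R) <= \dim R)%N.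
  rewrite dR; apply/maxR/asboolP; exists (I + R)%VS.
  by split=> //; [exact: lie_idealD|exact: lie_solvableD].
move=> dIR; have/eqP -> : (R == I + R)%VS by rewrite eqEdim addvSr.
exact: addvSl.
Qed.

End LieAlgebraTheory.

Section MainSpaces.

Context {K : fieldType} (g : lieAlgType K).
Local Open Scope classical_set_scope.

Definition radical : {vspace g} := xget 0%VS [set R | is_radical R].

Lemma radicalP : is_radical radical.
Proof. exact: (@xgetPex _ _ [set R | is_radical R] (@radical_exists K g)). Qed.

Definition Der : set 'End(g) := [set D | is_derivation D].

Definition Inn : set 'End(g) := [set ad x | x in [set: g]].

Definition AID : set 'End(g) :=
  [set D | Der D /\ forall x, exists y, D x = [lie y, x]].

End MainSpaces.

Arguments Der {K} g _.
Arguments Inn {K} g _.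
Arguments AID {K} g _.

(* Main.v *)
Require Import Defs.
From HB Require Import structures.
From mathcomp Require Import all_boot all_order all_algebra.
From mathcomp Require Import boolp classical_sets.

Set Implicit Arguments.
Unset Strict Implicit.
Unset Printing Implicit Defensive.

Import Order.TTheory GRing.Theory Num.Theory.
Local Open Scope ring_scope.

(** Let [A] be the radical of [g], abelian by hypothesis, and [s = g/A], which
has no nonzero abelian ideal; [s] acts on [A].

Reduction to [A].  An almost inner derivation [D] preserves every ideal, so it
induces a derivation of [s], which is inner because the first cohomology of a
semisimple algebra vanishes ([whitehead]).  Subtracting an inner derivation of
[g], we may assume that [D] maps [g] into [A].  If [D] also vanishes on [A], it
is a 1-cocycle of [s] with values in [A], hence it is inner, again by
[whitehead].  So everything rests on [almost_inner_vanishes]: [D] is zero on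
[A].

Why [D] vanishes on [A].  On [A] the map [D] commutes with [g].  Assume that
[M = D(A)] is not zero, and let [P] be an equivariant projection of [A] onto
[M] ([equivariant_projection], which is complete reducibility).  Take [x] in [g]
and [v] in [A].  Comparing [D x = [y0, x]] with [D (x + v) = [y1, x + v]] gives
[D v = [y1, v] + [x, b]] for some [b] in [A], with [y1] commuting with [x]
modulo [A], provided that brackets of [x] which fall into [A] can be neglected;
this is arranged by choosing [x] in a Levi supplement ([levi_supplement]).
Applying [P], [D v = [y1, P v] + [x, P b]].

Now choose [x] well.  By [principal_element], [s] contains a diagonalizable [h],
and a sum [x] of eigenvectors of [ad h] that are positive for a suitable order
on the eigenvalues, such that the centralizer of [x] has no component in the
centralizer of [h]: [x] is the sum of one root vector for each simple root, as in
the principal nilpotent element.  Let [m] be the lowest generalized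
eigenvalue of [h] on [M], and [v] of weight [m].  Then [[y1, P v]] has no component of
weight [m], because [y1] shifts weights by nonzero amounts, nor has
[[x, P b]], because [x] raises weights.  But [D v] has weight [m], so it is zero.
Hence [M] has no vector of weight [m], a contradiction.

The theory of semisimple Lie algebras that this needs is developed below from
generalized eigenspaces: Engel's theorem; Cartan's criterion, by means of
[Q]-linear functionals on the ground field; Whitehead's first lemma, by Casimir
operators; and Cartan subalgebras, as centralizers of diagonalizable elements
with as many distinct eigenvalues as possible. *)

(** * Subspaces and linear maps given by their properties *)
Section Comprehension.

Context {K : fieldType}.

Lemma lfun_of_linear (U V : vectType K) (f : U -> V) :
  linear f -> exists F : 'Hom(U, V), F =1 f.
Proof.
move=> flin; pose m := GRing.isLinear.Build K U V _ f flin.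
pose F : {linear U -> V} := HB.pack f m.
by exists (linfun F) => u; rewrite lfunE.
Qed.

Section LfunEqs.

Variables (U V : vectType K) (f : 'Hom(U, V)).

Lemma lfunZ a u : f (a *: u) = a *: f u. Proof. exact: linearZ. Qed.
Lemma lfunD u v : f (u + v) = f u + f v. Proof. exact: linearD. Qed.
Lemma lfunB u v : f (u - v) = f u - f v. Proof. exact: linearB. Qed.
Lemma lfunN u : f (- u) = - f u. Proof. exact: linearN. Qed.
Lemma lfun0 : f 0 = 0. Proof. exact: linear0. Qed.
Lemma lfun_sum (I : Type) (r : seq I) (P : pred I) (F : I -> U) :
  f (\sum_(i <- r | P i) F i) = \sum_(i <- r | P i) f (F i).
Proof. exact: linear_sum. Qed.

End LfunEqs.

Variable V : vectType K.

(** Comprehension for subspaces; it is [0] when [P] is not closed under linear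
combinations. *)
Definition vspace_of (P : V -> Prop) : {vspace V} :=
  xget 0%VS [set U : {vspace V} | forall v, v \in U <-> P v]%classic.

(** A subspace of maximal dimension among those contained in [P] is all of [P]. *)
Lemma mem_vspace_of (P : V -> Prop) :
  P 0 -> (forall a u v, P u -> P v -> P (a *: u + v)) ->
  forall v, v \in vspace_of P <-> P v.
Proof.
move=> P0 Plin; apply: (@xgetPex _ 0%VS
  [set U : {vspace V} | forall v, v \in U <-> P v]%classic).
pose inP n := `[< exists U : {vspace V}, (forall v, v \in U -> P v) /\ \dim U = n >].
have ex_inP : exists n, inP n.
  exists 0; apply/asboolP; exists 0%VS; rewrite dimv0.
  by split=> // v; rewrite memv0 => /eqP->.
have ubP n : inP n -> (n <= \dim {:V})%N.
  by move=> /asboolP[U [_ <-]]; apply/dimvS/subvf.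
case: (ex_maxnP ex_inP ubP) => n /asboolP[U [UP dimU]] maxU.
exists U => v; split=> [|Pv]; first exact: UP.
have /maxU : inP (\dim (<[v]> + U)).
  apply/asboolP; exists (<[v]> + U)%VS; split=> // w /memv_addP[_ /vlineP[a ->] [u /UP Pu ->]].
  exact: Plin.
rewrite -dimU => leU; have /eqP-> : U == (<[v]> + U)%VS by rewrite eqEdim addvSr.
exact/(subvP (addvSl _ _))/memv_line.
Qed.

End Comprehension.

Lemma subr_ACA (V : zmodType) (a b c d : V) : a - b - (c - d) = a - c - (b - d).
Proof. by rewrite !opprB addrACA [RHS]addrACA; congr (_ + _); rewrite addrC. Qed.

(** * The trace of an endomorphism *)

Section Trace.

Context {K : fieldType}.

Definition ltr (V : vectType K) (f : 'End(V)) : K :=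
  \sum_(i < \dim {:V}) coord (vbasis {:V}) i (f (vbasis {:V})`_i).

Lemma ltr_is_linear (V : vectType K) : linear_for *%R (@ltr V).
Proof.
move=> a f g; rewrite /ltr big_distrr -big_split /=; apply: eq_bigr => i _.
by rewrite add_lfunE scale_lfunE linearP.
Qed.

HB.instance Definition _ (V : vectType K) :=
  GRing.isLinear.Build K 'End(V) K _ (@ltr V) (@ltr_is_linear V).

(** Stated for maps between different spaces: this is what allows the trace of a
map to be computed on its image, by [lfun_factor]. *)
Lemma ltrC (U V : vectType K) (f : 'Hom(U, V)) (g : 'Hom(V, U)) :
  ltr (f \o g)%VF = ltr (g \o f)%VF.
Proof.
pose A (i : 'I_(\dim {:U})) (j : 'I_(\dim {:V})) :=
  coord (vbasis {:U}) i (g (vbasis {:V})`_j) *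
  coord (vbasis {:V}) j (f (vbasis {:U})`_i).
transitivity (\sum_j \sum_i A i j).
  apply: eq_bigr => j _; rewrite comp_lfunE.
  rewrite {1}(coord_vbasis (memvf (g (vbasis {:V})`_j))) !linear_sum.
  by apply: eq_bigr => i _; rewrite !linearZ.
rewrite exchange_big /=; apply: eq_bigr => i _; rewrite comp_lfunE.
rewrite {1}(coord_vbasis (memvf (f (vbasis {:U})`_i))) !linear_sum.
by apply: eq_bigr => j _; rewrite !linearZ /= mulrC.
Qed.

Lemma ltr1 (V : vectType K) : ltr (\1 : 'End(V)) = (\dim {:V})%:R.
Proof.
rewrite /ltr (eq_bigr (fun=> 1)) => [|i _]; last first.
  by rewrite id_lfunE coord_free ?eqxx // (basis_free (vbasisP _)).
by rewrite sumr_const card_ord.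
Qed.

Lemma lfun_factor (V : vectType K) (f : 'End(V)) :
  exists (f' : 'Hom(V, subvs_of (limg f))),
    forall v, vsval (f' v) = f v.
Proof.
exists (linfun (vsproj (limg f)) \o f)%VF => v.
by rewrite comp_lfunE lfunE vsprojK ?memv_img ?memvf.
Qed.

Lemma iter_lin (V : vectType K) (f : 'End(V)) n : linear (iter n f).
Proof.
move=> a u v; elim: n => [|n /= ->] //.
by rewrite linearP.
Qed.

Lemma iter_lin0 (V : vectType K) (f : 'End(V)) n : iter n f 0 = 0.
Proof. by elim: n => //= n ->; rewrite linear0. Qed.

Lemma iter_lin_sum (V : vectType K) (f : 'End(V)) n (I : Type) (r : seq I) (w : I -> V) :
  iter n f (\sum_(i <- r) w i) = \sum_(i <- r) iter n f (w i).
Proof.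
elim: r => [|i r IHr]; first by rewrite !big_nil iter_lin0.
by rewrite !big_cons -IHr -[w i in LHS]scale1r iter_lin scale1r.
Qed.

Lemma iter_lin_le (V : vectType K) (f : 'End(V)) m n v :
  (m <= n)%N -> iter m f v = 0 -> iter n f v = 0.
Proof. by move=> /subnK<- fv0; rewrite iterD fv0 iter_lin0. Qed.

Lemma dim_subvs (V : vectType K) (U : {vspace V}) : \dim {:subvs_of U} = \dim U.
Proof. by rewrite dimvf. Qed.

(** Local nilpotency, which in finite dimension is nilpotency: it spares a
uniform exponent. *)
Definition lnilp (V : vectType K) (f : 'End(V)) :=
  forall v, exists n, iter n f v = 0.

(** Write [f = j o f'] through its image; then [f' o j] is nilpotent on a smaller
space and has the same trace. *)
Lemma ltr_nilp (V : vectType K) (f : 'End(V)) : lnilp f -> ltr f = 0.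
Proof.
have [n] := ubnP (\dim {:V}); elim: n => // n IHn in V f *; rewrite ltnS => dimV nil_f.
have [f' f'E] := lfun_factor f.
pose j : 'Hom(subvs_of (limg f), V) := linfun vsval.
have -> : f = (j \o f')%VF by apply/lfunP=> v; rewrite comp_lfunE lfunE /= f'E.
rewrite ltrC; have [fV | fV] := eqVneq (limg f) {:V}%VS.
  have /eqP ker0 : lker f == 0%VS.
    have := limg_ker_dim f {:V}; rewrite fV capfv => /eqP.
    by rewrite -[X in _ == X]add0n eqn_add2r dimv_eq0.
  have V0 (v : V) : v = 0.
    have [k] := nil_f v; elim: k v => //= k IHk v fv0; apply: IHk.
    by apply/eqP; rewrite -memv0 -ker0 memv_ker fv0.
  by apply: big1 => i _; rewrite [X in coord _ _ X](_ : _ = 0) ?linear0 //; apply/val_inj/V0.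
apply: IHn => [|v].
  apply: leq_trans dimV; rewrite dim_subvs ltn_neqAle dimvS ?subvf // andbT.
  by apply: contraNneq fV => eqd; rewrite eqEdim subvf eqd leqnn.
have [k fk0] := nil_f (vsval v); exists k; apply: val_inj => /=; rewrite -[RHS]fk0.
by elim: k {fk0} => //= k <-; rewrite comp_lfunE lfunE /= f'E.
Qed.

Lemma ltr_proj (V : vectType K) (p : 'End(V)) :
  (forall v, p (p v) = p v) -> ltr p = (\dim (limg p))%:R.
Proof.
move=> pp; have [p' p'E] := lfun_factor p.
pose j : 'Hom(subvs_of (limg p), V) := linfun vsval.
have {1}-> : p = (j \o p')%VF by apply/lfunP=> v; rewrite comp_lfunE lfunE /= p'E.
rewrite ltrC (_ : (_ \o _)%VF = \1%VF) ?ltr1 ?dim_subvs //.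
apply/lfunP=> v; rewrite comp_lfunE id_lfunE; apply: val_inj; rewrite /= lfunE /= p'E.
by have /memv_imgP[u _ ->] := subvsP v; rewrite pp.
Qed.

End Trace.

(** * Generalized eigenvectors *)

Section GenEig.

Context {K : fieldType}.

Definition shift (V : vectType K) (f : 'End(V)) c : 'End(V) := f - c *: \1%VF.

Lemma shiftE (V : vectType K) (f : 'End(V)) c v : shift f c v = f v - c *: v.
Proof. by rewrite add_lfunE opp_lfunE scale_lfunE id_lfunE. Qed.

Definition geig (V : vectType K) (f : 'End(V)) c v :=
  exists n, iter n (shift f c) v = 0.

Lemma geig_eig (V : vectType K) (f : 'End(V)) c v : f v = c *: v -> geig f c v.
Proof. by move=> fv; exists 1%N; rewrite /= shiftE fv subrr. Qed.

Lemma geig0 (V : vectType K) (f : 'End(V)) c : geig f c 0.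
Proof. by exists 0. Qed.

Lemma geig_lin (V : vectType K) (f : 'End(V)) c a u v :
  geig f c u -> geig f c v -> geig f c (a *: u + v).
Proof.
move=> [m um] [n vn]; exists (maxn m n); rewrite iter_lin.
by rewrite (iter_lin_le (leq_maxl m n) um) (iter_lin_le (leq_maxr m n) vn) scaler0 addr0.
Qed.

Lemma geigZ (V : vectType K) (f : 'End(V)) c a u : geig f c u -> geig f c (a *: u).
Proof. by move=> fu; rewrite -[_ *: _]addr0; apply: geig_lin (geig0 _ _). Qed.

Lemma geigD (V : vectType K) (f : 'End(V)) c u v :
  geig f c u -> geig f c v -> geig f c (u + v).
Proof. by move=> fu fv; rewrite -[u]scale1r; apply: geig_lin. Qed.

Lemma geig_morph (U V : vectType K) (f : 'End(U)) (g : 'End(V)) (h : 'Hom(U, V)) c u :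
  (forall w, h (f w) = g (h w)) -> geig f c u -> geig g c (h u).
Proof.
move=> hfg [n fn]; exists n; rewrite -[RHS](lfun0 h) -fn.
by elim: n {fn} => //= n ->; rewrite !shiftE lfunB lfunZ hfg.
Qed.

Lemma geig_shift (V : vectType K) (f : 'End(V)) c d u :
  geig f c u -> geig f c (shift f d u).
Proof.
by apply: (geig_morph (h := shift f d)) => w; rewrite !shiftE lfunB lfunZ.
Qed.

Lemma geig_excl (V : vectType K) (f : 'End(V)) c d u :
  c != d -> geig f c u -> geig f d u -> u = 0.
Proof.
move=> cd [n]; elim: n u => //= n IHn u; rewrite -iterS iterSr => fc fd.
have fcu := IHn _ fc (geig_shift c fd).
have {}fcu : f u = c *: u by apply/eqP; rewrite -subr_eq0 -shiftE fcu.
have [m] := fd; have -> : iter m (shift f d) u = (c - d) ^+ m *: u.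
  elim: m => [|m /= ->]; first by rewrite scale1r.
  by rewrite lfunZ shiftE fcu -scalerBl scalerA exprSr.
by move/eqP; rewrite scaler_eq0 expf_eq0 subr_eq0 (negPf cd) andbF => /eqP.
Qed.

Lemma geig_solve (V : vectType K) (f : 'End(V)) (B : {vspace V}) c d u :
  (forall v, v \in B -> f v \in B) ->
  c != d -> geig f c u -> u \in B ->
  exists w, [/\ w \in B, geig f c w & shift f d w = u].
Proof.
move=> fB cd [n]; elim: n u => [|n IHn] u.
  by move=> /= -> _; exists 0; rewrite mem0v lfun0; split=> //; apply: geig0.
rewrite iterSr => fc uB.
have sB v : v \in B -> shift f c v \in B.
  by move=> vB; rewrite shiftE memvB ?memvZ ?fB.
have [w [wB fw wE]] := IHn _ fc (sB _ uB).
have cd0 : c - d != 0 by rewrite subr_eq0.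
exists ((c - d)^-1 *: (u - w)); split; first by rewrite memvZ ?memvB.
  apply/geigZ; rewrite addrC -scaleN1r; apply: geig_lin => //.
  by exists n.+1; rewrite iterSr.
apply: (scalerI cd0); rewrite lfunZ scalerA divff // scale1r lfunB wE.
by rewrite !shiftE scalerBl opprB addrC addrA subrK.
Qed.

Lemma geig_indep (V : vectType K) (f : 'End(V)) (r : seq K) (w : K -> V) :
  uniq r -> (forall c, geig f c (w c)) -> \sum_(c <- r) w c = 0 ->
  forall c, c \in r -> w c = 0.
Proof.
elim: r w => // d r IHr w /= /andP[dr ur] fw.
rewrite big_cons => sum0.
have [n fd] := fw d.
pose w' c := iter n (shift f d) (w c).
have w'0 c : c \in r -> w' c = 0.
  apply: IHr => // [c'|].
    by rewrite /w'; elim: n {fd w'} => //= n; apply: geig_shift.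
  have := congr1 (iter n (shift f d)) sum0.
  by rewrite iter_lin0 -[w d]scale1r iter_lin fd scaler0 add0r iter_lin_sum.
have wr c : c \in r -> w c = 0.
  move=> cr; apply: (geig_excl (d := d) _ (fw c)); last by exists n; apply: w'0.
  by apply: contraNneq dr => <-.
move=> c; rewrite inE => /predU1P[->|]; last exact: wr.
by rewrite -[LHS]addr0 -[RHS]sum0; congr (_ + _); rewrite big_seq big1.
Qed.

(** [f3] acts on [B u v] as a derivation, so that
[f3 - (c + d)] distributes over the two arguments as [f1 - c] and [f2 - d].
This is the source of all additivity of weights below. *)
Lemma geig_bilinear (U V W : vectType K) (B : U -> V -> W)
    (f1 : 'End(U)) (f2 : 'End(V)) (f3 : 'End(W)) c d u v :
  (forall v, linear (B^~ v)) -> (forall u, linear (B u)) ->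
  (forall u v, f3 (B u v) = B (f1 u) v + B u (f2 v)) ->
  geig f1 c u -> geig f2 d v -> geig f3 (c + d) (B u v).
Proof.
move=> Bl Br f3B [m fu] [n fv].
have B0l w : B 0 w = 0.
  by have := Bl w (-1) 0 0; rewrite scaleN1r addr0 oppr0 scaleN1r addNr.
have B0r w : B w 0 = 0.
  by have := Br w (-1) 0 0; rewrite scaleN1r addr0 oppr0 scaleN1r addNr.
exists (m + n)%N; have [k le_k] := ubnP (m + n)%N.
elim: k m n u v le_k fu fv => // k IHk [|m] [|n] u v; rewrite ?ltnS => le_k fu fv.
- by rewrite /= in fu; rewrite fu B0l iter_lin0.
- by rewrite /= in fu; rewrite fu B0l iter_lin0.
- by rewrite /= in fv; rewrite fv B0r iter_lin0.
have -> : (m.+1 + n.+1 = (m + n).+2)%N by rewrite addnS.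
rewrite iterSr.
have -> : shift f3 (c + d) (B u v) = 1 *: B (shift f1 c u) v + B u (shift f2 d v).
  have BBl : B (shift f1 c u) v = B (f1 u) v - c *: B u v.
    by rewrite shiftE addrC -scaleNr (Bl v (-c)) scaleNr addrC.
  have BBr : B u (shift f2 d v) = B u (f2 v) - d *: B u v.
    by rewrite shiftE addrC -scaleNr (Br u (-d)) scaleNr addrC.
  by rewrite scale1r BBl BBr shiftE f3B scalerDl opprD addrACA.
rewrite iter_lin scale1r.
have -> : iter (m + n).+1 (shift f3 (c + d)) (B (shift f1 c u) v) = 0.
  by rewrite -addnS; apply: IHk; rewrite -?iterSr // addnS; rewrite addnS addSn in le_k.
rewrite add0r -addSn; apply: IHk; rewrite -?iterSr //.
by move: le_k; rewrite addnS.
Qed.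

End GenEig.

(** * Spectral decomposition over a closed field *)

Section Spectral.

Context {K : closedFieldType}.

Lemma eigenvector_full (V : vectType K) (f : 'End(V)) : {:V}%VS != 0%VS ->
  exists c v, v != 0 /\ f v = c *: v.
Proof.
move=> V0; have basV := vbasisP {:V}.
pose A := passmx.mxof (vbasis {:V}) (vbasis {:V}) f.
have : size (char_poly A) != 1%N by rewrite size_char_poly eqSS dimv_eq0.
move=> /closed_rootP[c]; rewrite -eigenvalue_root_char.
rewrite /eigenvalue -(passmx.vsof_eq0 basV) -(passmx.leigenspaceE basV) => eig0.
exists c, (vpick (passmx.leigenspace f c)); split; first by rewrite vpick0.
apply/eqP; rewrite -subr_eq0; have := memv_pick (passmx.leigenspace f c).
by rewrite memv_ker add_lfunE opp_lfunE scale_lfunE id_lfunE.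
Qed.

Definition restr (V : vectType K) (B : {vspace V}) (f : 'End(V)) : 'End(subvs_of B) :=
  (linfun (vsproj B) \o f \o linfun vsval)%VF.

Lemma restrE (V : vectType K) (B : {vspace V}) (f : 'End(V)) :
  (forall v, v \in B -> f v \in B) -> forall v, vsval (restr B f v) = f (vsval v).
Proof. by move=> fB v; rewrite !comp_lfunE !lfunE /= vsprojK ?fB ?subvsP. Qed.

Lemma eigenvector (V : vectType K) (B : {vspace V}) (f : 'End(V)) :
  (forall v, v \in B -> f v \in B) -> B != 0%VS ->
  exists c v, [/\ v \in B, v != 0 & f v = c *: v].
Proof.
move=> fB B0; have : {:subvs_of B}%VS != 0%VS by rewrite -dimv_eq0 dim_subvs dimv_eq0.
move=> /(eigenvector_full (restr B f))[c [v [v0 fv]]].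
exists c, (vsval v); split; first exact: subvsP.
  by apply: contraNneq v0 => v0; apply/eqP/val_inj.
by rewrite -restrE // fv.
Qed.

(** Induction on the dimension of the stable subspace [B]: if [c] is an eigenvalue
on [B], then [(f - c) B] is smaller; decompose [(f - c) v] there and divide its
components of weight [d <> c] by [f - c]; the remainder has weight [c].  Working
inside an arbitrary stable [B] shows at the same time that the components of
an element of [B] stay in [B]. *)
Lemma geig_decomp (V : vectType K) (B : {vspace V}) (f : 'End(V)) :
  (forall v, v \in B -> f v \in B) ->
  exists r : seq K, [/\ uniq r, (size r <= \dim B)%N & forall v, v \in B ->
    exists w : K -> V, (forall c, w c \in B /\ geig f c (w c)) /\ v = \sum_(c <- r) w c].
Proof.
have [n] := ubnP (\dim B); elim: n => // n IHn in B *; rewrite ltnS => dimB fB.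
have [->|B0] := eqVneq B 0%VS.
  exists [::]; split=> // v; rewrite memv0 => /eqP->; exists (fun=> 0); split.
    by move=> c; rewrite mem0v; split=> //; apply: geig0.
  by rewrite big_nil.
have [c [b [bB b0 fb]]] := eigenvector fB B0.
pose B' := (shift f c @: B)%VS.
have fB' v : v \in B' -> f v \in B'.
  move=> /memv_imgP[u uB ->].
  have -> : f (shift f c u) = shift f c (f u) by rewrite !shiftE lfunB lfunZ.
  exact/memv_img/fB.
have sB' : (B' <= B)%VS.
  by apply/subvP => _ /memv_imgP[u uB ->]; rewrite shiftE memvB ?memvZ ?fB.
have ltB : (\dim B' < \dim B)%N.
  rewrite -(limg_ker_dim (shift f c) B) -add1n leq_add2r lt0n.
  rewrite dimv_eq0; apply: contraNneq b0 => ker0; rewrite -memv0 -ker0.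
  by rewrite memv_cap bB memv_ker shiftE fb subrr eqxx.
have ltB' := leq_trans ltB dimB.
have [r [ur sr rP]] := IHn _ ltB' fB'.
exists (c :: [seq d <- r | d != c]); split.
- by rewrite /= filter_uniq // mem_filter eqxx.
- by apply: leq_trans ltB; rewrite /= ltnS; apply: leq_trans sr; rewrite size_filter count_size.
move=> v vB; have [w [wP vE]] := rP _ (memv_img (shift f c) vB).
have ex_u d : exists u, [/\ u \in B, geig f d u & d != c -> shift f c u = w d].
  have [-> | dc] := eqVneq d c.
    by exists 0; rewrite mem0v; split=> //; apply: geig0.
  have [wB fw] := wP d.
  have [u [uB fu uE]] := geig_solve fB dc fw (subvP sB' _ wB).
  by exists u.
pose u d := xget 0 [set u | [/\ u \in B, geig f d u & d != c -> shift f c u = w d]]%classic.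
have uP d : [/\ u d \in B, geig f d (u d) & d != c -> shift f c (u d) = w d].
  exact: (@xgetPex _ 0
    [set u | [/\ u \in B, geig f d u & d != c -> shift f c u = w d]]%classic (ex_u d)).
pose v0 := v - \sum_(d <- r | d != c) u d.
have v0B : v0 \in B by rewrite memvB ?memv_suml // => d _; have [] := uP d.
have fv0 : geig f c v0.
  suff [n0 E] : geig f c (shift f c v0) by exists n0.+1; rewrite iterSr.
  rewrite lfunB lfun_sum vE (bigID (fun d => d == c)) /=.
  rewrite [X in _ + X - _](eq_bigr (fun d => shift f c (u d))); last first.
    by by move=> d dc; have [_ _ ->] := uP d.
  rewrite addrK; apply: big_ind => [|x y|d /eqP->]; first exact: geig0.
    exact: geigD.
  by have [] := wP c.
exists (fun d => if d == c then v0 else u d); split=> [d|].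
  by case: eqP => [->|_]; [|have [] := uP d].
rewrite big_cons eqxx big_filter addrC -[LHS](subrK (\sum_(d <- r | d != c) u d)) addrC.
by congr (_ + _); apply: eq_bigr => d /negPf->.
Qed.

(** The decomposition as an induction principle, the form in which it is mostly
used: an additive property need only be checked on weight vectors. *)
Lemma geig_ind (V : vectType K) (B : {vspace V}) (f : 'End(V)) (Q : V -> Prop) :
  (forall v, v \in B -> f v \in B) ->
  Q 0 -> (forall u v, Q u -> Q v -> Q (u + v)) ->
  (forall c v, v \in B -> geig f c v -> Q v) -> forall v, v \in B -> Q v.
Proof.
move=> fB Q0 QD QP v vB; have [r [_ _ /(_ v vB)[w [wP ->]]]] := geig_decomp fB.
by apply: big_ind => // c _; have [wB fw] := wP c; apply: QP fw.
Qed.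

Lemma geig_lfunP (V W : vectType K) (f : 'End(V)) (g h : 'Hom(V, W)) :
  (forall c v, geig f c v -> g v = h v) -> g = h.
Proof.
move=> gh; apply/lfunP=> v.
apply: (@geig_ind V {:V} f (fun v => g v = h v)) (memvf v) => [u _||u w|c u _].
- exact: memvf.
- by rewrite !lfun0.
- by rewrite !lfunD => -> ->.
- exact: gh.
Qed.

Lemma geig_projectors (V : vectType K) (f : 'End(V)) :
  exists (r : seq K) (p : K -> 'End(V)),
  [/\ uniq r /\ (size r <= \dim {:V})%N, forall c v, geig f c (p c v), forall v, v = \sum_(c <- r) p c v,
      forall c v, geig f c v -> p c v = v &
      forall c d v, c != d -> geig f c v -> p d v = 0].
Proof.
have [//|r [ur sr rP]] := @geig_decomp V {:V} f _; first by move=> v _; apply: memvf.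
have ex_w v : exists w : K -> V,
    [/\ forall c, geig f c (w c), v = \sum_(c <- r) w c & forall c, c \notin r -> w c = 0].
  have [w [wP vE]] := rP v (memvf v).
  exists (fun c => if c \in r then w c else 0); split=> [c|| c /negPf->//].
    by case: ifP => _; [have [] := wP c | apply: geig0].
  by rewrite {1}vE big_seq [RHS]big_seq; apply: eq_bigr => c ->.
have {}[q qP] := choice ex_w.
have q_uniq v w : (forall c, geig f c (w c)) -> v = \sum_(c <- r) w c ->
    (forall c, c \notin r -> w c = 0) -> forall c, q v c = w c.
  move=> fw vE w0 c; have [fq qE q0] := qP v.
  have [cr|cr] := boolP (c \in r); last by rewrite q0 ?w0.
  apply/eqP; rewrite -subr_eq0; apply/eqP.
  apply: (@geig_indep _ _ f r (fun c => q v c - w c)) => // [d|].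
    by rewrite addrC -scaleN1r; apply: geig_lin.
  by rewrite sumrB -qE -vE subrr.
have q_lin c : linear (fun v => q v c).
  move=> a u v; have [fu uE u0] := qP u; have [fv vE v0] := qP v.
  apply: (q_uniq (a *: u + v) (fun c => a *: q u c + q v c)) => [d||d dr].
  - exact: geig_lin.
  - by rewrite big_split /= -scaler_sumr -uE -vE.
  - by rewrite u0 // v0 // scaler0 addr0.
have {q_lin}[p pE] := choice (fun c => lfun_of_linear (q_lin c)).
have pgeig c d v : geig f c v -> p d v = if d == c then v else 0.
  move=> fv; have [cr|cr] := boolP (c \in r).
    rewrite pE (q_uniq v (fun d => if d == c then v else 0)) // => [e||e er].
    - by case: eqP => [->|_]; last exact: geig0.
    - by rewrite (bigD1_seq c) //= eqxx big1 ?addr0 // => e /negPf->.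
    - by case: eqP => // ec; rewrite -ec (negPf er) in cr.
  have v0 : v = 0.
    have [fq qE q0] := qP v.
    have := @geig_indep _ _ f (c :: r) (fun d => if d == c then v else - q v d).
    rewrite /= cr ur => /(_ isT) /(_ _ _ c); rewrite eqxx mem_head; apply=> //.
      by move=> e; case: eqP => [->//|_]; rewrite -scaleN1r; apply: geigZ.
    rewrite big_cons eqxx {1}qE -big_split /= big_seq big1 // => e er.
    by case: eqP => [ec|_]; [rewrite -ec er in cr | rewrite subrr].
  by rewrite v0 lfun0; case: ifP.
exists r, p; split=> //.
- by move=> c v; rewrite pE; have [] := qP v.
- by move=> v; have [_ vE _] := qP v; rewrite {1}vE; apply: eq_bigr => c _; rewrite pE.
- by move=> c v /pgeig->; rewrite eqxx.
- by move=> c d v cd /pgeig->; rewrite eq_sym (negPf cd).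
Qed.

(** Functional calculus for the semisimple part of [f]: [S chi] is [chi] applied to
the eigenvalues.  In the trace formula [n c] is the multiplicity of [c]; the
nilpotent part of [f] does not contribute. *)
Lemma spectral_function (V : vectType K) (f : 'End(V)) :
  exists (r : seq K) (n : K -> nat) (S : (K -> K) -> 'End(V)),
  [/\ uniq r,
      (forall c v, geig f c v -> v != 0 -> c \in r),
      (forall c, c \in r -> (0 < n c)%N),
      (forall chi c v, geig f c v -> S chi v = chi c *: v) &
      (forall chi, ltr (S chi \o f)%VF = \sum_(c <- r) chi c * c * (n c)%:R)].
Proof.
have [r [p [[ur _] gp pE p1 p0]]] := geig_projectors f.
pose r' := [seq c <- r | p c != 0].
pose S chi : 'End(V) := \sum_(c <- r) chi c *: p c.
have SE chi c v : geig f c v -> S chi v = chi c *: v.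
  move=> fv; rewrite sum_lfunE; have [cr|cr] := boolP (c \in r).
    rewrite (bigD1_seq c) //= scale_lfunE p1 // big1 ?addr0 // => d dc.
    by rewrite scale_lfunE (p0 c) ?scaler0 // eq_sym.
  have v0 : v = 0.
    rewrite [v]pE big_seq big1 // => d dr; apply: (p0 c) => //.
    by apply: contraNneq cr => ->.
  by rewrite v0 scaler0 big1 // => d _; rewrite lfun0.
have pn0 c v : geig f c v -> v != 0 -> p c != 0.
  by move=> fv; apply: contraNneq => pc0; rewrite -(p1 _ _ fv) pc0 zero_lfunE.
have pos c : p c != 0 -> (0 < \dim (limg (p c)))%N.
  rewrite lt0n dimv_eq0; apply: contraNneq => img0; apply/eqP/lfunP=> v.
  by rewrite zero_lfunE; apply/eqP; rewrite -memv0 -img0 memv_img ?memvf.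
exists r', (fun c => \dim (limg (p c))), S; split=> //.
- exact: filter_uniq.
- move=> c v fv v0; rewrite mem_filter (pn0 _ _ fv v0) /=; apply: contraNT v0 => cr; rewrite [v]pE big_seq big1 // => d dr.
  by apply: (p0 c) => //; apply: contraNneq cr => ->.
- by move=> c; rewrite mem_filter => /andP[/pos].
move=> chi; pose D := S id; have -> : (S chi \o f = S (fun c => (chi c * c)%R) + (S chi \o (f - D)))%VF.
  have -> : S (fun c => chi c * c) = (S chi \o D)%VF; last first.
    by rewrite comp_lfunDr comp_lfunNr addrCA subrr addr0.
  apply: (@geig_lfunP _ _ f) => c u fu; rewrite comp_lfunE.
  by rewrite (SE _ c) // /D (SE id c) // lfunZ (SE chi c) // scalerA mulrC.
rewrite linearD /= [X in _ + X]ltr_nilp ?addr0.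
  rewrite /S linear_sum big_filter [RHS]big_mkcond /=; apply: eq_bigr => c _.
  rewrite linearZ /= ltr_proj => [|v]; last by rewrite p1.
  case: eqP => [->|//]; rewrite (_ : limg (0%R : 'End(V)) = 0%VS) ?dimv0 ?mulr0 //.
  by apply/eqP; rewrite -lkerE; apply/subvP=> v _; rewrite memv_ker zero_lfunE.
move=> v.
apply: (@geig_ind V {:V} f (fun v => exists n, iter n (S chi \o (f - D))%VF v = 0))
  (memvf v).
- by move=> u _; apply: memvf.
- by exists 0.
- move=> u w [m um] [k wk]; exists (maxn m k); rewrite -[u]scale1r iter_lin.
  by rewrite (iter_lin_le (leq_maxl m k) um) (iter_lin_le (leq_maxr m k) wk) scaler0 addr0.
move=> c u _ fu; have [m um] := fu; exists m.
have gm k : geig f c (iter k (shift f c) u) by elim: k => //= k; apply: geig_shift.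
suff -> : iter m (S chi \o (f - D))%VF u = chi c ^+ m *: iter m (shift f c) u.
  by rewrite um scaler0.
elim: m {um} => [|m /= ->]; first by rewrite scale1r.
rewrite lfunZ comp_lfunE add_lfunE opp_lfunE /D (SE id c) // -shiftE.
by rewrite (SE chi c) ?scalerA ?exprSr //; apply: geig_shift.
Qed.

(** Over a closed field this is diagonalizability. *)
Definition semisimple_op (V : vectType K) (f : 'End(V)) :=
  forall c v, geig f c v -> f v = c *: v.

Lemma semisimple_opP (V : vectType K) (f : 'End(V)) :
  (forall Q : V -> Prop, Q 0 -> (forall u v, Q u -> Q v -> Q (u + v)) ->
     (forall c v, f v = c *: v -> Q v) -> forall v, Q v) -> semisimple_op f.
Proof.
move=> span c v fv; have [r [p [_ gp pE p1 p0]]] := geig_projectors f.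
rewrite -[v](p1 c) //; apply: (span (fun v => f (p c v) = c *: p c v)) => [||d w fw].
- by rewrite !lfun0 scaler0.
- by move=> u w; rewrite !lfunD scalerDr => -> ->.
have [dc|dc] := eqVneq d c; last by rewrite (p0 d) ?lfun0 ?scaler0 //; apply: geig_eig.
by rewrite -dc (p1 d) //; apply: geig_eig.
Qed.

Lemma eigenvalues_bound (V : vectType K) (f : 'End(V)) (r : seq K) :
  uniq r -> (forall c, c \in r -> exists v, v != 0 /\ f v = c *: v) ->
  (size r <= \dim {:V})%N.
Proof.
move=> ur rP; have [r' [p [[_ sr'] gp pE p1 p0]]] := geig_projectors f.
apply: leq_trans sr'; apply: uniq_leq_size => // c /rP[v [v0 fv]].
apply: contraNT v0 => cr'; rewrite [v]pE big_seq big1 // => d dr'.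
by apply: (p0 c); [apply: contraNneq cr' => -> | apply: geig_eig].
Qed.

End Spectral.

(** * Rational functionals on a field of characteristic zero *)

Section RationalFunctionals.

Context {K : fieldType}.
Hypothesis char0 : [pchar K] =i pred0.

Lemma char0_natr_eq0 n : (n%:R == 0 :> K) = (n == 0)%N.
Proof. by move/pcharf0P: char0 => ->. Qed.

Lemma char0_intr_eq0 (m : int) : (m%:~R == 0 :> K) = (m == 0).
Proof. by case: m => n; rewrite ?NegzE ?mulrNz ?oppr_eq0 -?pmulrn char0_natr_eq0. Qed.

(** In an arbitrary field of characteristic zero [ratr] is a ring morphism; this
formula, independent of the reduced fraction, yields all its laws. *)
Lemma ratr_frac (a b : int) : b != 0 -> ratr (a%:~R / b%:~R) = a%:~R / b%:~R :> K.
Proof.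
move=> b0; set q := _ / _; have bK : b%:~R != 0 :> K by rewrite char0_intr_eq0.
have dK : (denq q)%:~R != 0 :> K by rewrite char0_intr_eq0 denq_neq0.
apply/eqP; rewrite /ratr eqr_div // -!intrM; apply/eqP; congr (_%:~R).
apply: (intr_inj (R := rat)); rewrite !intrM -{1}[numq q]mulr1.
have bQ : b%:~R != 0 :> rat by rewrite intr_eq0.
have dQ : (denq q)%:~R != 0 :> rat by rewrite intr_eq0 denq_neq0.
by apply/eqP; rewrite mulr1 -eqr_div // divq_num_den.
Qed.

Lemma rat_fracE (q : rat) : exists a b : int, b != 0 /\ q = a%:~R / b%:~R.
Proof. by exists (numq q), (denq q); rewrite denq_neq0 divq_num_den. Qed.

Lemma char0_ratrD (p q : rat) : ratr (p + q) = ratr p + ratr q :> K.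
Proof.
have [a [b [b0 ->]]] := rat_fracE p; have [c [d [d0 ->]]] := rat_fracE q.
rewrite addf_div ?intr_eq0 // -!intrM -intrD !ratr_frac ?mulf_neq0 //.
by rewrite addf_div ?char0_intr_eq0 // !intrM intrD !intrM.
Qed.

Lemma char0_ratrM (p q : rat) : ratr (p * q) = ratr p * ratr q :> K.
Proof.
have [a [b [b0 ->]]] := rat_fracE p; have [c [d [d0 ->]]] := rat_fracE q.
by rewrite mulf_div -!intrM !ratr_frac ?mulf_neq0 // mulf_div !intrM.
Qed.

Lemma char0_ratr0 : ratr 0 = 0 :> K.
Proof. by have := @ratr_frac 0 1 isT; rewrite !mul0r. Qed.

Lemma char0_ratr1 : ratr 1 = 1 :> K.
Proof. by have := @ratr_frac 1 1 isT; rewrite !divr1. Qed.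

Lemma char0_ratrN q : ratr (- q) = - ratr q :> K.
Proof. by apply/eqP; rewrite -addr_eq0 -char0_ratrD addNr char0_ratr0. Qed.

Definition Qlinear (F : K -> rat) :=
  forall q u v, F (ratr q * u + v) = q * F u + F v.

(** Zorn's lemma on graphs of partial [Q]-linear functionals that take the value [1]
at [c0]: a maximal graph whose domain misses [c] could be extended to the line
through [c]. *)
Lemma Qlinear_functional c0 : c0 != 0 -> exists F, Qlinear F /\ F c0 = 1.
Proof.
move=> c00.
pose P (X : set (K * rat)) :=
  [/\ forall q u a v b, X (u, a) -> X (v, b) -> X (ratr q * u + v, q * a + b),
      forall a, X (0, a) -> a = 0 & forall a, X (c0, a) -> a = 1].
have [|X [[Xlin X0 Xc0] Xmax]] := @Zorn_bigcup _ P.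
  move=> F FP Ftot; split=> [q u a v b [X FX Xu] [Y FY Yv]|a|a].
  - have [XY|YX] := Ftot X Y FX FY.
      by exists Y => //; have [+ _ _] := FP Y FY; apply=> //; apply: XY.
    by exists X => //; have [+ _ _] := FP X FX; apply=> //; apply: YX.
  - by move=> [X FX]; have [_ + _] := FP X FX; apply.
  - by move=> [X FX]; have [_ _] := FP X FX; apply.
have Xfun u a b : X (u, a) -> X (u, b) -> a = b.
  move=> Xa Xb; apply/eqP; rewrite -subr_eq0; apply/eqP/X0.
  have := Xlin (-1) _ _ _ _ Xb Xa.
  by rewrite char0_ratrN char0_ratr1 !mulN1r addNr addrC.
(* a maximal graph might be empty a priori, so the origin is adjoined to it *)
pose X1 : set (K * rat) := [set x | X x \/ x = (0, 0)]%classic.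
have X1lin q u a v b : X1 (u, a) -> X1 (v, b) -> X1 (ratr q * u + v, q * a + b).
  move=> [Xu|[-> ->]] [Xv|[-> ->]]; rewrite ?mulr0 ?add0r ?addr0; [left|left|left|right] => //.
    exact: Xlin.
  have := Xlin (q - 1) _ _ _ _ Xu Xu.
  by rewrite char0_ratrD char0_ratrN char0_ratr1 !mulrBl !mul1r !subrK.
have X1Z q u a : X1 (u, a) -> X1 (ratr q * u, q * a).
  by move=> /X1lin/(_ (or_intror erefl)) => /(_ q); rewrite !addr0.
have X10 a : X1 (0, a) -> a = 0 by case=> [/X0|[]].
have X1c0 a : X1 (c0, a) -> a = 1.
  by case=> [/Xc0//|[c00']]; rewrite c00' eqxx in c00.
(* [t] is the value to be given to [c] *)
have ext c (t : rat) : (forall a, ~ X (c, a)) -> (c = c0 -> t = 1) ->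
    (c <> c0 -> exists a, X1 (c0, a)) -> False.
  move=> cX ct cc0.
  have cX1 a : c != 0 -> ~ X1 (c, a) by move=> c_0 [/cX//|[c0' _]]; rewrite c0' eqxx in c_0.
  pose Y : set (K * rat) := [set x | exists r u a, X1 (u, a) /\
     x = (ratr r * c + u, r * t + a)]%classic.
  have c_n0 : c <> 0 -> c != 0 by move/eqP.
  have key r u : c != 0 -> (exists a, X1 (u, a)) -> (exists b, X1 (ratr r * c + u, b)) -> r = 0.
    move=> c_0 [a ua] [b ub]; apply/eqP; apply: contraT => r0.
    exfalso; apply: (@cX1 (r^-1 * (-1 * a + b))) => //.
    have := X1Z r^-1 _ _ (X1lin (-1) _ _ _ _ ua ub).
    rewrite char0_ratrN char0_ratr1 [_ * u]mulN1r [- u + _]addrCA addNr addr0 mulrA -char0_ratrM.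
    by rewrite mulVf // char0_ratr1 mul1r.
  have c_0 : c != 0.
    apply/eqP => c_0; have Yext : P (X `|` [set (0, 0)])%classic.
      by split=> [q u a v b|a|a]; [apply: X1lin | apply: X10 | apply: X1c0].
    apply: (Xmax _ _ Yext); split=> [|sub]; first by move=> x; left.
    by apply: (cX 0); rewrite c_0; apply: sub; right.
  apply: (Xmax Y).
    split=> [[u a] Xu|sub].
      exists 0, u, a; split; first by left.
      by rewrite char0_ratr0 !mul0r !add0r.
    apply: (cX t); apply: sub; exists 1, 0, 0; split; first by right.
    by rewrite char0_ratr1 !mul1r !addr0.
  split.
  - move=> q u a v b [r [u' [a' [Xu [-> ->]]]]] [s [v' [b' [Xv [-> ->]]]]].
    exists (q * r + s), (ratr q * u' + v'), (q * a' + b'); split; first exact: X1lin.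
    by rewrite char0_ratrD char0_ratrM !mulrDr !mulrDl !mulrA; congr (_, _); rewrite addrACA.
  - move=> a [r [u [b [Xu [E ->]]]]].
    have r0 : r = 0 by apply: (key r u) => //; [exists b | exists 0; rewrite -E; right].
    move: E; rewrite r0 char0_ratr0 !mul0r !add0r => E; apply: X10; by rewrite E.
  - move=> a [r [u [b [Xu [E ->]]]]]; have [cc|/eqP cc] := eqVneq c c0.
      have r1 : r - 1 = 0.
        apply: (key _ u) => //; first by exists b.
        exists 0; right; congr (_, _).
        by rewrite char0_ratrD char0_ratrN char0_ratr1 mulrBl mul1r addrAC -E cc subrr.
      have {}r1 : r = 1 by apply/eqP; rewrite -subr_eq0 r1.
      move: E; rewrite r1 char0_ratr1 !mul1r ct // -cc => /esym/eqP.
      by rewrite -subr_eq0 addrAC subrr add0r => /eqP u0; rewrite (X10 b) ?addr0 // -u0.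
    have r0 : r = 0 by apply: (key r u); [|exists b|rewrite -E; apply: cc0].
    move: E; rewrite r0 char0_ratr0 !mul0r !add0r => E; apply: X1c0; by rewrite E.
have domc0 : exists a, X (c0, a).
  apply: contrapT => nX; apply: (ext c0 1) => // a Xa.
  by apply: nX; exists a.
have dom c : exists a, X (c, a).
  apply: contrapT => nX; have [a Xa] := domc0; apply: (ext c 0).
  - by move=> b Xb; apply: nX; exists b.
  - by move=> cc; case: nX; rewrite cc; exists a.
  - by exists a; left.
have [F FX] := choice dom; exists F; split; last exact: Xc0.
by move=> q u v; apply: Xfun (FX _) _; apply: Xlin.
Qed.

Lemma QlinearD F u v : Qlinear F -> F (u + v) = F u + F v.
Proof. by move=> /(_ 1 u v); rewrite char0_ratr1 !mul1r. Qed.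

Lemma Qlinear0 F : Qlinear F -> F 0 = 0.
Proof. by move=> FL; apply: (addrI (F 0)); rewrite -QlinearD // !addr0. Qed.

Lemma QlinearZ F q u : Qlinear F -> F (ratr q * u) = q * F u.
Proof. by move=> FL; rewrite -[_ * u]addr0 FL Qlinear0 // addr0. Qed.

Lemma QlinearN F u : Qlinear F -> F (- u) = - F u.
Proof.
by move=> FL; apply/eqP; rewrite -addr_eq0 -QlinearD // addNr Qlinear0.
Qed.

Lemma Qlinear_sum (F : K -> rat) (r : seq K) (w : K -> K) :
  Qlinear F -> F (\sum_(c <- r) w c) = \sum_(c <- r) F (w c).
Proof.
move=> FL; elim: r => [|c r IHr]; first by rewrite !big_nil Qlinear0.
by rewrite !big_cons QlinearD // IHr.
Qed.

Lemma QlinearMn (F : K -> rat) u n : Qlinear F -> F (u *+ n) = F u *+ n.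
Proof.
move=> FL; elim: n => [|n IHn]; first by rewrite !mulr0n Qlinear0.
by rewrite !mulrS QlinearD // IHn.
Qed.

Lemma avoid_finite (F : fieldType) (r : seq F) :
  [pchar F] =i pred0 -> exists t : F, t \notin r.
Proof.
move=> F0; pose s : seq F := [seq n%:R | n <- iota 0 (size r).+1].
have us : uniq s.
  rewrite map_inj_uniq ?iota_uniq // => m n /eqP.
  have /pcharf0P natF0 := F0.
  wlog le_mn : m n / (m <= n)%N.
    by move=> W; have [/W//|/ltnW/W W'] := leqP m n; rewrite eq_sym => /W'.
  rewrite eq_sym -subr_eq0 -natrB // natF0 subn_eq0 => le_nm.
  by apply/eqP; rewrite eqn_leq le_mn.
apply: contrapT => nex; have /(uniq_leq_size us) : {subset s <= r}.
  by move=> t _; apply: contrapT => /negP tr; apply: nex; exists t.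
by rewrite size_map size_iota ltnn.
Qed.

(** A rational vector space is not a finite union of hyperplanes: if [F] works for
[r] and [G c <> 0], then [t F + G] works for [c :: r] for all but finitely many
[t]. *)
Lemma Qlinear_nonvanishing (r : seq K) :
  exists F, Qlinear F /\ forall c, c \in r -> c != 0 -> F c != 0.
Proof.
elim: r => [|c r [F [FL Fr]]].
  by exists (fun=> 0); split=> // q u v; rewrite mulr0 addr0.
have [c0|c0] := eqVneq c 0.
  by exists F; split=> // d; rewrite inE => /predU1P[->|/Fr//]; rewrite c0 eqxx.
have [G [GL Gc]] := Qlinear_functional c0.
have [t tr] := @avoid_finite rat [seq - G d / F d | d <- c :: r] (pchar_num _).
exists (fun u => t * F u + G u); split.
  by move=> q u v; rewrite FL GL !mulrDr addrACA !mulrA [t * q]mulrC.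
move=> d dr d0; apply: contraNneq tr => /eqP; rewrite addrC addr_eq0 => /eqP Gd.
have [Fd0|Fd0] := eqVneq (F d) 0; last first.
  by apply/mapP; exists d => //; rewrite Gd opprK mulfK.
move: dr; rewrite inE => /predU1P[dc|/Fr/(_ d0)]; last by rewrite Fd0 eqxx.
by move: Gd; rewrite Fd0 mulr0 oppr0 dc Gc => /eqP; rewrite oner_eq0.
Qed.

End RationalFunctionals.

(** * Engel's theorem *)

Section LieBasics.

Context {K : fieldType} {g : lieAlgType K}.
Implicit Types (x y z : g) (M W I : {vspace g}).

Lemma brack0r x : [lie x, 0] = 0. Proof. exact: linear0. Qed.
Lemma brackZr a x y : [lie x, a *: y] = a *: [lie x, y]. Proof. exact: linearZ. Qed.
Lemma brackDr x y z : [lie x, y + z] = [lie x, y] + [lie x, z]. Proof. exact: linearD. Qed.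
Lemma brackNr x y : [lie x, - y] = - [lie x, y]. Proof. exact: linearN. Qed.
Lemma brackBr x y z : [lie x, y - z] = [lie x, y] - [lie x, z]. Proof. exact: linearB. Qed.
Lemma brack0l x : [lie 0, x] = 0. Proof. by rewrite brackC brack0r oppr0. Qed.
Lemma brackDl x y z : [lie x + y, z] = [lie x, z] + [lie y, z].
Proof. by rewrite brackC brackDr opprD -!brackC. Qed.
Lemma brackNl x y : [lie - x, y] = - [lie x, y].
Proof. by rewrite brackC brackNr -brackC. Qed.
Lemma brackBl x y z : [lie x - y, z] = [lie x, z] - [lie y, z].
Proof. by rewrite brackDl brackNl. Qed.

Lemma brackJ x y z : [lie x, [lie y, z]] = [lie [lie x, y], z] + [lie y, [lie x, z]].
Proof.
have /eqP := jacobi x y z; rewrite -addrA addr_eq0 => /eqP->.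
by rewrite (brackC [lie x, y]) (brackC x z) brackNr opprD addrC.
Qed.

Lemma brackJl x y z : [lie [lie x, y], z] = [lie x, [lie y, z]] - [lie y, [lie x, z]].
Proof. by rewrite (brackJ x) addrK. Qed.

Definition lie_subalg M := forall x y, x \in M -> y \in M -> [lie x, y] \in M.

(** The maximal proper subalgebra is characterized by what is used of it: a
subalgebra strictly above it is everything. *)
Lemma max_subalg M : M != 0%VS -> exists M', [/\ (M' <= M)%VS, lie_subalg M',
  ~~ (M <= M')%VS & forall N, (N <= M)%VS -> lie_subalg N -> (M' <= N)%VS ->
     ~~ (N <= M')%VS -> N = M].
Proof.
move=> M0.
pose P n := `[< exists N, [/\ (N <= M)%VS, lie_subalg N, ~~ (M <= N)%VS & \dim N = n] >].
have exP : exists n, P n.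
  exists 0%N; apply/asboolP; exists 0%VS; rewrite sub0v dimv0 subv0; split=> //.
  by move=> x y; rewrite !memv0 => /eqP-> _; rewrite brack0l.
have ubP n : P n -> (n <= \dim M)%N by move=> /asboolP[N [NM _ _ <-]]; apply: dimvS.
case: (ex_maxnP exP ubP) => n /asboolP[M' [M'M sM' M'neq dM']] maxn.
exists M'; split=> // N NM sN M'N NM'; apply/eqP; apply: contraT => neqN.
have /maxn : P (\dim N).
  by apply/asboolP; exists N; split=> //; rewrite eqEsubv NM in neqN.
by rewrite -dM' leqNgt ltn_neqAle dimvS // andbT (dimv_leqif_sup M'N) NM'.
Qed.

Lemma subalg_add_line M x : lie_subalg M -> (forall y, y \in M -> [lie y, x] \in M) ->
  lie_subalg (M + <[x]>)%VS.
Proof.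
move=> sM Mx _ _ /memv_addP[u uM [_ /vlineP[a ->] ->]] /memv_addP[v vM [_ /vlineP[b ->] ->]].
apply: (subvP (addvSl _ _)); rewrite brackDl !brackDr !brackZr !brackZl bracketxx.
by rewrite (brackC x v) !scaler0 addr0 !memvD ?sM ?memvZ ?memvN ?Mx.
Qed.

Lemma add_line_neq M x : x \notin M -> ~~ (M + <[x]> <= M)%VS.
Proof. by apply: contra => /subvP-> //; apply/(subvP (addvSr _ _))/memv_line. Qed.

(** Engel's theorem for the adjoint action on the subquotient [W / W'].  Induction
on [M]: for a maximal proper subalgebra [M'], the theorem for [M'] acting on
[M / M'] gives [x] with [M = M' + <[x]>] and [M'] normalized by [x]; the vectors that
[M'] kills modulo [W'] are stable under the nilpotent [ad x], which therefore
kills one of them. *)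
Lemma engel M W' W :
  lie_subalg M ->
  (forall x w, x \in M -> w \in M -> exists n, iter n (ad x) w = 0) ->
  (forall x w, x \in M -> w \in W -> exists n, iter n (ad x) w = 0) ->
  (forall x w, x \in M -> w \in W' -> [lie x, w] \in W') ->
  (forall x w, x \in M -> w \in W -> [lie x, w] \in W) ->
  ~~ (W <= W')%VS ->
  exists w, [/\ w \in W, w \notin W' & forall x, x \in M -> [lie x, w] \in W'].
Proof.
have [n] := ubnP (\dim M); elim: n => // n IHn in M W' W *; rewrite ltnS.
move=> dimM sM nilM nilW stW' stW neqW.
have [M0 | M0] := eqVneq M 0%VS.
  have [w wW wW'] := subvPn neqW; exists w; split=> // x.
  by rewrite M0 memv0 => /eqP->; rewrite brack0l mem0v.
have [M' [/subvP M'M sM' M'neq maxM']] := max_subalg M0.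
have ltM' : (\dim M' < n)%N.
  apply: leq_trans dimM; rewrite ltn_neqAle dimvS ?andbT; last exact/subvP.
  by rewrite (dimv_leqif_sup (introT subvP M'M)).
have nilM'V (V : {vspace g}) : (forall x w, x \in M -> w \in V -> exists n, iter n (ad x) w = 0) ->
  forall x w, x \in M' -> w \in V -> exists n, iter n (ad x) w = 0.
  by move=> nilV x w /M'M; apply: nilV.
have nilM' : forall x w, x \in M' -> w \in M' -> exists n, iter n (ad x) w = 0.
  by move=> x w xM' /M'M; apply: nilM'V.
have stM'V (V : {vspace g}) : (forall x w, x \in M -> w \in V -> [lie x, w] \in V) ->
  forall x w, x \in M' -> w \in V -> [lie x, w] \in V.
  by move=> stV x w /M'M; apply: stV.
have [x [xM xM' M'x]] :=
  IHn M' M' M ltM' sM' nilM' (nilM'V _ nilM) sM' (stM'V _ sM) M'neq.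
have ME : (M' + <[x]>)%VS = M.
  apply: maxM'; rewrite ?addvSl ?add_line_neq //; last exact: subalg_add_line.
  by rewrite subv_add -memvE xM andbT; apply/subvP.
have [w0 [w0W w0W' M'w0]] :=
  IHn M' W' W ltM' sM' nilM' (nilM'V _ nilW) (stM'V _ stW') (stM'V _ stW) neqW.
have ex_k : exists k, iter k (ad x) w0 \in W'.
  by have [k E] := nilW _ _ xM w0W; exists k; rewrite E mem0v.
case: (ex_minnP ex_k) => [[|k]] Wk mink; first by rewrite /= (negPf w0W') in Wk.
have inW'' i : iter i (ad x) w0 \in W /\
    forall y, y \in M' -> [lie y, iter i (ad x) w0] \in W'.
  elim: i => //= i [iW M'i]; rewrite adE; split; first exact: stW.
  move=> y yM'; rewrite brackJ memvD ?M'i ?M'x //.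
  by apply: stW' => //; apply: M'i.
have [wW M'w] := inW'' k; exists (iter k (ad x) w0); split=> //.
  by apply/negP => /mink; rewrite ltnn.
move=> y; rewrite -ME => /memv_addP[u /M'w uW' [_ /vlineP[a ->] ->]].
by rewrite brackDl brackZl memvD ?memvZ // -adE.
Qed.

(** By the same argument a maximal proper subalgebra would be an ideal of
codimension one, and contain the derived algebra. *)
Lemma engel_perfect M :
  (forall x w, x \in M -> w \in M -> exists n, iter n (ad x) w = 0) ->
  brackv M M = M -> M = 0%VS.
Proof.
move=> nilM perM; apply/eqP; apply: contraT => M0.
have sM : lie_subalg M by move=> x y xM yM; rewrite -perM memv_brack.
have [M' [/subvP M'M sM' M'neq maxM']] := max_subalg M0.
have [||||x [xM xM' M'x]] := engel (W := M) sM' _ _ _ _ M'neq.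
- by move=> x w /M'M xM /M'M; apply: nilM.
- by move=> x w /M'M; apply: nilM.
- exact: sM'.
- by move=> x w /M'M xM; apply: sM.
have ME : (M' + <[x]>)%VS = M.
  apply: maxM'; rewrite ?addvSl ?add_line_neq //; last exact: subalg_add_line.
  by rewrite subv_add -memvE xM andbT; apply/subvP.
suff : (brackv M M <= M')%VS by rewrite perM (negPf M'neq).
apply/brackv_subP => y z; rewrite -ME.
move=> /memv_addP[u uM [_ /vlineP[a ->] ->]] /memv_addP[v vM [_ /vlineP[b ->] ->]].
rewrite brackDl !brackDr !brackZr !brackZl bracketxx.
by rewrite (brackC x v) !scaler0 addr0 !memvD ?sM' ?memvZ ?memvN ?M'x.
Qed.

Lemma brackv_ideal I J : lie_ideal I -> lie_ideal J -> lie_ideal (brackv I J).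
Proof.
move=> iI iJ x y; suff : (brackv I J <= (ad x @^-1: brackv I J))%VS.
  by move/subvP => sub /sub; rewrite -memv_preim adE.
apply/brackv_subP => u v uI vJ; rewrite -memv_preim adE brackJ memvD //.
  by apply: memv_brack => //; apply: iI.
by apply: memv_brack => //; apply: iJ.
Qed.

Lemma derived_series_ideal I n : lie_ideal I -> lie_ideal (derived_series I n).
Proof. by move=> iI; elim: n => //= n IHn; apply: brackv_ideal. Qed.

Lemma derived_series_sub I n : lie_ideal I -> (derived_series I n <= I)%VS.
Proof.
move=> iI; elim: n => //= n IHn; apply: subv_trans IHn.
by apply/brackv_subP => x y _; apply: derived_series_ideal.
Qed.

(** The last term of the derived series of [I]. *)
Lemma perfect_core I : lie_ideal I ->
  exists P, [/\ lie_ideal P, (P <= I)%VS, brackv P P = P & P = 0%VS -> lie_solvable I].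
Proof.
move=> iI; pose D n := derived_series I n.
have ex_d : exists d, `[< exists n, \dim (D n) = d >].
  by exists (\dim (D 0%N)); apply/asboolP; exists 0%N.
case: (ex_minnP ex_d) => d /asboolP[n Dn] mind.
exists (D n); split.
- exact: derived_series_ideal.
- exact: derived_series_sub.
- apply/eqP; rewrite eqEdim Dn; apply/andP; split.
    by apply/brackv_subP => x y _; apply: derived_series_ideal.
  by apply: mind; apply/asboolP; exists n.+1.
by move=> Dn0; exists n.
Qed.

(** Equivalent to the absence of nonzero solvable ideals, by [semisimple_solvable]. *)
Definition lie_semisimple := forall I, lie_ideal I -> lie_abelian I -> I = 0%VS.

Lemma semisimple_solvable I : lie_semisimple -> lie_ideal I -> lie_solvable I -> I = 0%VS.
Proof.
move=> ss iI [n]; elim: n => //= n IHn Dn.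
by apply: IHn; apply: ss => //; apply: derived_series_ideal.
Qed.

End LieBasics.

Arguments lie_semisimple {K} g.

(** * Representations and their trace forms *)

Section Representations.

Context {K : fieldType} {g : lieAlgType K}.

Lemma ad_is_linear : linear (@ad K g).
Proof.
move=> a x y; apply/lfunP=> z.
by rewrite add_lfunE scale_lfunE !adE brackDl brackZl.
Qed.

HB.instance Definition _ := GRing.isLinear.Build K g 'End(g) _ (@ad K g) ad_is_linear.

Definition lie_rep (V : vectType K) (rho : 'Hom(g, 'End(V))) :=
  forall x y v, rho [lie x, y] v = rho x (rho y v) - rho y (rho x v).

Definition adr : 'Hom(g, 'End(g)) := linfun (@ad K g).

Lemma adrE x y : adr x y = [lie x, y]. Proof. by rewrite lfunE /= adE. Qed.

Lemma adr_rep : lie_rep adr.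
Proof. by move=> x y v; rewrite !adrE brackJl. Qed.

Section TraceForm.

Variables (V : vectType K) (rho : 'Hom(g, 'End(V))).

Definition trform x y : K := ltr (rho x \o rho y)%VF.

Lemma trformC x y : trform x y = trform y x. Proof. exact: ltrC. Qed.

Lemma trform_linearl y : linear_for *%R (trform^~ y).
Proof.
move=> a u v; rewrite /trform -linearP; congr ltr; apply/lfunP=> w.
by rewrite !(comp_lfunE, add_lfunE, scale_lfunE, lfunD, lfunZ).
Qed.

Lemma trform_linear x : linear_for *%R (trform x).
Proof. by move=> a u v; rewrite !(trformC x) trform_linearl. Qed.

Lemma trformD x u v : trform x (u + v) = trform x u + trform x v.
Proof. by rewrite -[u]scale1r trform_linear mul1r scale1r. Qed.

Lemma trform0 x : trform x 0 = 0.
Proof. by apply: (addrI (trform x 0)); rewrite -trformD !addr0. Qed.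

Lemma trformZ x a u : trform x (a *: u) = a * trform x u.
Proof. by rewrite -[_ *: _]addr0 trform_linear trform0 addr0. Qed.

Lemma trformN x u : trform x (- u) = - trform x u.
Proof. by rewrite -scaleN1r trformZ mulN1r. Qed.

Lemma trformB x u v : trform x (u - v) = trform x u - trform x v.
Proof. by rewrite trformD trformN. Qed.

Lemma trform_sum (I : Type) (r : seq I) x (u : I -> g) :
  trform x (\sum_(i <- r) u i) = \sum_(i <- r) trform x (u i).
Proof.
elim: r => [|i r IHr]; first by rewrite !big_nil trform0.
by rewrite !big_cons trformD IHr.
Qed.

Hypothesis rep : lie_rep rho.

Lemma repE x y : rho [lie x, y] = ((rho x \o rho y) - (rho y \o rho x))%VF.
Proof. by apply/lfunP=> v; rewrite rep add_lfunE opp_lfunE !comp_lfunE. Qed.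

Lemma trform_inv x y z : trform [lie x, y] z = trform x [lie y, z].
Proof.
rewrite /trform !repE comp_lfunDl comp_lfunDr comp_lfunNl comp_lfunNr !linearB /=.
congr (_ - _); first by rewrite comp_lfunA.
by rewrite -comp_lfunA ltrC comp_lfunA.
Qed.

Lemma trform_invN x y z : trform [lie y, x] z = - trform x [lie y, z].
Proof. by rewrite brackC trformC trformN trformC trform_inv. Qed.

End TraceForm.

Definition killing := trform adr.

Definition trperp (V : vectType K) (rho : 'Hom(g, 'End(V))) (I : {vspace g}) : {vspace g} :=
  vspace_of (fun x => forall y, y \in I -> trform rho x y = 0).

Lemma mem_trperp (V : vectType K) (rho : 'Hom(g, 'End(V))) I x :
  x \in trperp rho I <-> forall y, y \in I -> trform rho x y = 0.
Proof.
apply: mem_vspace_of => [y _|a u v Pu Pv y yI]; first by rewrite trformC trform0.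
by rewrite trform_linearl Pu // Pv // mulr0 addr0.
Qed.

Lemma trperp_ideal (V : vectType K) (rho : 'Hom(g, 'End(V))) I :
  lie_rep rho -> lie_ideal I -> lie_ideal (trperp rho I).
Proof.
move=> rep iI x y /mem_trperp yP; apply/mem_trperp => z zI.
by rewrite trform_invN // yP ?oppr0 //; apply: iI.
Qed.

Lemma cap_ideal (I J : {vspace g}) : lie_ideal I -> lie_ideal J -> lie_ideal (I :&: J)%VS.
Proof. by move=> iI iJ x y /memv_capP[yI yJ]; rewrite memv_cap iI // iJ. Qed.

(** Riesz representation for a nondegenerate form, by counting dimensions. *)
Lemma trform_represent (V : vectType K) (rho : 'Hom(g, 'End(V))) (I : {vspace g}) (phi : g -> K) :
  linear_for *%R phi ->
  (forall x, x \in I -> (forall y, y \in I -> trform rho x y = 0) -> x = 0) ->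
  exists x, x \in I /\ forall y, y \in I -> trform rho x y = phi y.
Proof.
move=> phi_lin nondeg; pose n := \dim I; pose e := vbasis I.
have T_lin : linear (fun x => \row_(j < n) trform rho x e`_j).
  by move=> a u v; apply/rowP=> j; rewrite !mxE trform_linearl.
have [T TE] := lfun_of_linear T_lin.
have phi0 : phi 0 = 0.
  by apply: (addrI (phi 0)); rewrite -{1}[phi 0]mul1r -phi_lin scale1r !addr0.
have phi_sum (c : 'I_n -> K) : phi (\sum_j c j *: e`_j) = \sum_j c j * phi e`_j.
  by elim/big_rec2: _ => [//|j y1 y2 _ <-]; rewrite phi_lin.
have Tinj x : x \in I -> T x = 0 -> x = 0.
  move=> xI Tx; apply: nondeg => // y yI; rewrite (coord_vbasis yI) trform_sum big1 // => j _.
  have := congr1 (fun r : 'rV_n => r 0 j) Tx.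
  by rewrite TE !mxE trformZ => ->; rewrite mulr0.
have TI : (T @: I = fullv)%VS.
  apply/eqP; rewrite eqEdim subvf /= dimvf /dim /= mul1n limg_dim_eq //.
  apply/eqP; rewrite -subv0; apply/subvP=> x /memv_capP[xI].
  by rewrite memv_ker memv0 => /eqP/Tinj->.
have : \row_j phi e`_j \in (T @: I)%VS by rewrite TI memvf.
case/memv_imgP=> x xI xE; exists x; split=> // y yI.
rewrite (coord_vbasis yI) phi_sum trform_sum; apply: eq_bigr => j _; rewrite trformZ.
by have := congr1 (fun r : 'rV_n => r 0 j) xE; rewrite TE !mxE => ->.
Qed.

(** The tensor [\sum_i e i (x) e' i] formed from dual bases of an ideal is invariant.
Its invariance is stated through an arbitrary bilinear map [G], which
avoids tensor products. *)
Lemma dual_bases (V : vectType K) (rho : 'Hom(g, 'End(V))) (J : {vspace g}) :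
  lie_rep rho -> lie_ideal J ->
  (forall x, x \in J -> (forall y, y \in J -> trform rho x y = 0) -> x = 0) ->
  exists e e' : 'I_(\dim J) -> g,
   (forall i, trform rho (e i) (e' i) = 1) /\
   (forall (W : vectType K) (G : g -> g -> W) y,
      (forall v, linear (G^~ v)) -> (forall u, linear (G u)) ->
      \sum_i (G [lie y, e i] (e' i) + G (e i) [lie y, e' i]) = 0).
Proof.
move=> rep iJ nondeg; pose n := \dim J; pose e (i : 'I_n) := (vbasis J)`_i.
have eJ i : e i \in J by apply/vbasis_mem/mem_nth; rewrite size_tuple.
have ex_e' j : exists x, x \in J /\ forall i, trform rho x (e i) = (i == j)%:R.
  have [|x [xJ xE]] := @trform_represent V rho J (coord (vbasis J) j) _ nondeg.
    by move=> a u v; rewrite linearP.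
  exists x; split=> // i; rewrite xE // coord_free ?(basis_free (vbasisP J)) //.
have [e' e'P] := choice ex_e'.
have e'E z : z \in J -> z = \sum_i trform rho z (e i) *: e' i.
  move=> zJ; apply/eqP; rewrite -subr_eq0; apply/eqP/nondeg => [|y yJ].
    by rewrite memvB ?memv_suml // => i _; rewrite memvZ //; have [] := e'P i.
  rewrite trformC trformB trform_sum (coord_vbasis yJ) -/e.
  set c := coord (vbasis J); apply/eqP; rewrite subr_eq0; apply/eqP.
  rewrite trformC trform_sum; apply: eq_bigr => i _.
  rewrite !trformZ mulrC; congr (_ * _); rewrite trformC trform_sum (bigD1 i) //=.
  rewrite trformZ (e'P i).2 eqxx mulr1 big1 ?addr0 // => j ji.
  by rewrite trformZ (e'P i).2 (negPf ji) mulr0.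
exists e, e'; split=> [i|W G y Gl Gr].
  by rewrite trformC (e'P i).2 eqxx.
have G_sumr u (c : 'I_n -> K) (w : 'I_n -> g) :
    G u (\sum_i c i *: w i) = \sum_i c i *: G u (w i).
  have [F FE] := lfun_of_linear (Gr u).
  by rewrite -FE lfun_sum; apply: eq_bigr => i _; rewrite lfunZ FE.
have G_suml v (c : 'I_n -> K) (w : 'I_n -> g) :
    G (\sum_i c i *: w i) v = \sum_i c i *: G (w i) v.
  have [F FE] := lfun_of_linear (Gl v).
  by rewrite -(FE (\sum_i _)) lfun_sum; apply: eq_bigr => i _; rewrite lfunZ FE.
pose a i j := trform rho (e' j) [lie y, e i].
have yE i : [lie y, e i] = \sum_j a i j *: e j.
  rewrite {1}(coord_vbasis (iJ y _ (eJ i))); apply: eq_bigr => j _; congr (_ *: _).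
  rewrite /a {2}(coord_vbasis (iJ y _ (eJ i))) trform_sum (bigD1 j) //=.
  rewrite trformZ -/(e j) (e'P j).2 eqxx mulr1 big1 ?addr0 // => k kj.
  by rewrite trformZ -/(e k) (e'P j).2 (negPf kj) mulr0.
have yE' i : [lie y, e' i] = \sum_j - a j i *: e' j.
  rewrite {1}(e'E _ (iJ y _ (e'P i).1)); apply: eq_bigr => j _.
  by rewrite trform_invN.
rewrite big_split /= [X in X + _](eq_bigr (fun i => \sum_j a i j *: G (e j) (e' i))).
  2: by move=> i _; rewrite yE G_suml.
rewrite [X in _ + X](eq_bigr (fun i => \sum_j - a j i *: G (e i) (e' j))).
  2: by move=> i _; rewrite yE' G_sumr.
rewrite exchange_big /= -big_split big1 //= => i _; rewrite -big_split big1 //= => j _.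
by rewrite scaleNr subrr.
Qed.

End Representations.

Arguments killing {K g} x y.

(** * Cartan's criterion and the Killing form *)

Section CartanCriterion.

Context {K : closedFieldType}.
Hypothesis char0 : [pchar K] =i pred0.

Lemma commutator_op (V : vectType K) (f : 'End(V)) :
  exists a : 'End('End(V)), forall T : 'End(V), a T = ((f \o T) - (T \o f))%VF.
Proof.
apply: lfun_of_linear => a S T; apply/lfunP=> v.
by rewrite !(add_lfunE, opp_lfunE, scale_lfunE, comp_lfunE, lfunD, lfunZ) scalerBr opprD addrACA.
Qed.

Lemma geig_commutator (V : vectType K) (f : 'End(V)) (a : 'End('End(V))) c d T v :
  (forall T : 'End(V), a T = ((f \o T) - (T \o f))%VF) ->
  geig a c T -> geig f d v -> geig f (c + d) (T v).
Proof.
move=> aE; apply: (geig_bilinear (B := fun (T : 'End(V)) v => T v)).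
- by move=> w b S S'; rewrite /= add_lfunE scale_lfunE.
- by move=> S b w w'; rewrite lfunD lfunZ.
- by move=> S w; rewrite aE add_lfunE opp_lfunE !comp_lfunE subrK.
Qed.

Lemma geig_nilp0 (V : vectType K) (f : 'End(V)) :
  (forall c v, geig f c v -> v != 0 -> c = 0) -> forall v, geig f 0 v.
Proof.
move=> f0 v; apply: (@geig_ind K V {:V} f (geig f 0)) (memvf v).
- by move=> u _; apply: memvf.
- exact: geig0.
- by move=> u w; apply: geigD.
move=> c u _ fu; have [->|u0] := eqVneq u 0; first exact: geig0.
by rewrite -(f0 _ _ fu u0).
Qed.

Lemma shift0 (V : vectType K) (f : 'End(V)) : shift f 0 = f.
Proof. by rewrite /shift scale0r subr0. Qed.

Lemma lnilp_geig (V : vectType K) (f : 'End(V)) : lnilp f <-> forall v, geig f 0 v.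
Proof. by rewrite /lnilp /geig shift0. Qed.

Lemma commutator_nilp (V : vectType K) (f : 'End(V)) (a : 'End('End(V))) :
  (forall T : 'End(V), a T = ((f \o T) - (T \o f))%VF) -> lnilp f -> lnilp a.
Proof.
move=> aE /lnilp_geig f0; apply/lnilp_geig/geig_nilp0 => c T aT.
apply: contraNeq => c0; apply/eqP/lfunP=> v; rewrite zero_lfunE.
have := geig_commutator aE aT (f0 v); rewrite addr0 => fc.
exact: geig_excl c0 fc (f0 _).
Qed.

Variable s : lieAlgType K.

(** Let [y] act as the rational number [F c] on the weight space of weight [c] of
[rho x].  Bracketing with [y] is then the same function of bracketing with
[rho x], so it preserves [rho P].  As [x] is a sum of brackets in [P],
invariance of the trace turns [tr (y o rho x)] into values of the trace form on [P], so it
is zero: [\sum_c n_c F(c) c = 0].  Applying [F] gives [\sum_c n_c F(c)^2 = 0] in [rat],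
hence [F] vanishes on the spectrum; since [F] may be chosen nonzero at any given
nonzero eigenvalue, the spectrum is [0]. *)
Lemma trace_zero_nilp (V : vectType K) (rho : 'Hom(s, 'End(V))) (P : {vspace s}) :
  lie_rep rho -> brackv P P = P ->
  (forall x y, x \in P -> y \in P -> trform rho x y = 0) ->
  forall x, x \in P -> lnilp (rho x).
Proof.
move=> rep perP tr0 x xP; have [r [n [S [ur rP n0 SE trS]]]] := spectral_function (rho x).
apply/lnilp_geig/geig_nilp0 => c0 v0 fv0 v00; have c0r := rP _ _ fv0 v00.
apply/eqP; apply: contraT => c0n0.
have [F [FL Fc0]] := Qlinear_functional char0 c0n0.
pose chi c : K := ratr (F c); pose y := S chi.
have [a aE] := commutator_op (rho x).
have yP u : u \in P -> ((y \o rho u) - (rho u \o y))%VF \in (rho @: P)%VS.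
  move=> uP; apply: (@geig_ind K 'End(V) (rho @: P)%VS a
    (fun T => ((y \o T) - (T \o y))%VF \in (rho @: P)%VS)) (memv_img rho uP).
  - move=> _ /memv_imgP[w wP ->]; rewrite aE -repE // memv_img //.
    by rewrite -perP memv_brack.
  - by rewrite comp_lfun0l comp_lfun0r subrr mem0v.
  - move=> T T' yT yT'; rewrite comp_lfunDl comp_lfunDr opprD addrACA; exact: memvD.
  move=> d T TP aT; suff -> : ((y \o T) - (T \o y))%VF = chi d *: T by apply: memvZ.
  apply: (@geig_lfunP _ _ _ (rho x)) => c v fv.
  rewrite add_lfunE opp_lfunE scale_lfunE !comp_lfunE /y (SE chi c v fv) lfunZ.
  have chiD : chi (d + c) = chi d + chi c by rewrite /chi (QlinearD char0) // char0_ratrD.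
  by rewrite (SE chi (d + c)) ?chiD ?scalerDl ?addrK //; apply: geig_commutator aE aT fv.
have try0 : ltr (y \o rho x)%VF = 0.
  pose W : {vspace s} := vspace_of (fun z => ltr (y \o rho z)%VF = 0).
  have memW z : z \in W <-> ltr (y \o rho z)%VF = 0.
    apply: mem_vspace_of => [|b u v yu yv]; first by rewrite lfun0 comp_lfun0r linear0.
    by rewrite lfunD lfunZ comp_lfunDr -comp_lfunZr linearD linearZ /= yu yv mulr0 addr0.
  apply/memW; suff /subvP : (brackv P P <= W)%VS by rewrite perP; apply.
  apply/brackv_subP => u w uP wP; apply/memW; rewrite repE //.
  have /memv_imgP[z zP yz] := yP u uP.
  rewrite -[RHS](tr0 z w) // /trform -yz comp_lfunDr comp_lfunDl !comp_lfunNr comp_lfunNl.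
  rewrite !linearB /= !comp_lfunA; congr (_ - _).
  by rewrite ltrC comp_lfunA.
have := congr1 F try0; rewrite trS (Qlinear_sum char0) // (Qlinear0 char0) //.
rewrite (eq_bigr (fun c => F c ^+ 2 *+ n c)) => [|c _]; last first.
  by rewrite mulr_natr (QlinearMn char0) // (QlinearZ char0).
rewrite (bigD1_seq c0) //= Fc0 expr1n => /eqP; rewrite gt_eqF //.
apply: ltr_wpDr; first by apply: sumr_ge0 => c _; rewrite mulrn_wge0 ?sqr_ge0.
by rewrite pmulrn_rgt0 ?n0.
Qed.

(** The elements of [P] act nilpotently, hence are ad-nilpotent since [rho] is
faithful on [P], and Engel's theorem forbids a nonzero perfect [P]. *)
Theorem cartan_criterion (V : vectType K) (rho : 'Hom(s, 'End(V))) (P : {vspace s}) :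
  lie_rep rho -> brackv P P = P -> {in P &, injective rho} ->
  (forall x y, x \in P -> y \in P -> trform rho x y = 0) -> P = 0%VS.
Proof.
move=> rep perP inj tr0; apply: engel_perfect => // x w xP wP.
have [a aE] := commutator_op (rho x).
(* iterates of [ad x] on [w] correspond under [rho] to iterated commutators with [rho x] *)
have [n an0] := commutator_nilp aE (trace_zero_nilp rep perP tr0 xP) (rho w).
exists n; suff [E wP'] : rho (iter n (ad x) w) = iter n a (rho w) /\ iter n (ad x) w \in P.
  by apply: inj; rewrite ?mem0v // E lfun0.
elim: n {an0} => //= n [E wP']; rewrite adE; split; last by rewrite -perP memv_brack.
by rewrite repE // -E aE.
Qed.

Hypothesis ss : lie_semisimple s.

(** The perfect core of [I] is zero by Cartan's criterion, so [I] is solvable. *)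
Lemma isotropic_ideal0 (V : vectType K) (rho : 'Hom(s, 'End(V))) (I : {vspace s}) :
  lie_rep rho -> lie_ideal I -> {in I &, injective rho} ->
  (forall x y, x \in I -> y \in I -> trform rho x y = 0) -> I = 0%VS.
Proof.
move=> rep iI inj tr0; have [P [_ /subvP PI perP solv]] := perfect_core iI.
apply: (semisimple_solvable ss iI); apply/solv/(cartan_criterion rep perP).
  by move=> x y /PI xI /PI yI; apply: inj.
by move=> x y /PI xI /PI yI; apply: tr0.
Qed.

Lemma semisimple_center0 (x : s) : (forall y, [lie y, x] = 0) -> x = 0.
Proof.
move=> xZ; pose Z : {vspace s} := vspace_of (fun x => forall y, [lie y, x] = 0).
have memZ z : z \in Z <-> forall y, [lie y, z] = 0.
  apply: mem_vspace_of => [y|a u v Zu Zv y]; first exact: brack0r.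
  by rewrite brackDr brackZr Zu Zv scaler0 addr0.
suff Z0 : Z = 0%VS by apply/eqP; rewrite -memv0 -Z0; apply/memZ.
apply: ss => [y z /memZ->|]; first exact: mem0v.
by apply/eqP; rewrite -subv0; apply/brackv_subP => y z _ /memZ->; apply: mem0v.
Qed.

Lemma ad_inj (x y : s) : ad x = ad y -> x = y.
Proof.
move=> adxy; apply/eqP; rewrite -subr_eq0; apply/eqP/semisimple_center0 => z.
by rewrite brackC brackBl -!adE adxy subrr oppr0.
Qed.

Lemma adr_inj (I : {vspace s}) : {in I &, injective (@adr K s)}.
Proof. by move=> x y _ _ E; apply: ad_inj; apply/lfunP=> z; rewrite !adE -!adrE E. Qed.

Lemma killing_nondegenerate_ideal (I : {vspace s}) x : lie_ideal I ->
  x \in I -> (forall y, y \in I -> killing x y = 0) -> x = 0.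
Proof.
move=> iI xI xperp; pose J := (I :&: trperp (@adr K s) I)%VS.
suff J0 : J = 0%VS.
  by apply/eqP; rewrite -memv0 -J0 memv_cap xI; apply/mem_trperp.
apply: (isotropic_ideal0 (@adr_rep K s)); last 2 first.
- exact: adr_inj.
- by move=> y z /memv_capP[_ /mem_trperp yI] /memv_capP[zI _]; apply: yI.
by apply: cap_ideal => //; apply: trperp_ideal => //; apply: adr_rep.
Qed.

Lemma fullv_ideal : lie_ideal {:s}%VS.
Proof. by move=> x y _; apply: memvf. Qed.

Lemma killing_nondegenerate (x : s) : (forall y, killing x y = 0) -> x = 0.
Proof.
move=> xperp; apply: (killing_nondegenerate_ideal fullv_ideal) => //; exact: memvf.
Qed.

Lemma ideal_complement (I : {vspace s}) : lie_ideal I ->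
  (I + trperp (@adr K s) I)%VS = fullv.
Proof.
move=> iI; apply/eqP; rewrite eqEsubv subvf; apply/subvP=> x _.
have [||i [iI' iE]] := @trform_represent _ s _ (@adr K s) I (killing x).
- exact: trform_linear.
- by move=> y yI; apply: killing_nondegenerate_ideal.
rewrite -[x](subrKC i) memv_add //; apply/mem_trperp => y yI.
by rewrite trformC trformB [trform _ y i]trformC iE // trformC subrr.
Qed.

Lemma semisimple_perfect : brackv {:s} {:s} = {:s}%VS.
Proof.
have iD : lie_ideal (brackv {:s} {:s} : {vspace s}).
  by apply: brackv_ideal; apply: fullv_ideal.
rewrite -[LHS]addv0 -[RHS](ideal_complement iD); congr (_ + _)%VS.
apply/esym/eqP; rewrite -subv0; apply/subvP=> x /mem_trperp xperp; rewrite (_ : x = 0) ?mem0v //.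
apply: semisimple_center0 => y; apply: killing_nondegenerate => z.
rewrite /killing trform_invN; last exact: adr_rep.
by rewrite xperp ?oppr0 // memv_brack ?memvf.
Qed.

End CartanCriterion.

(** * Whitehead's first lemma *)

Section Whitehead.

Context {K : closedFieldType}.
Hypothesis char0 : [pchar K] =i pred0.
Variable s : lieAlgType K.
Hypothesis ss : lie_semisimple s.

(** The form to dualize is the trace form of [rho] on the Killing complement [J] of
[ker rho]: it is nondegenerate there by [isotropic_ideal0], and the
trace of the Casimir operator is [\dim J]. *)
Lemma casimir (V : vectType K) (rho : 'Hom(s, 'End(V))) :
  lie_rep rho -> rho != 0 ->
  exists n (e e' : 'I_n -> s),
   let C := \sum_i (rho (e i) \o rho (e' i))%VF in
   [/\ ltr C != 0, (forall x v, C (rho x v) = rho x (C v)) &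
   forall (W : vectType K) (G : s -> s -> W) y,
      (forall v, linear (G^~ v)) -> (forall u, linear (G u)) ->
      \sum_i (G [lie y, e i] (e' i) + G (e i) [lie y, e' i]) = 0].
Proof.
move=> rep rho0.
have iI : lie_ideal (lker rho).
  move=> x y; rewrite !memv_ker => /eqP y0; apply/eqP/lfunP=> v.
  by rewrite rep y0 !zero_lfunE lfun0 subrr.
pose J := trperp (@adr K s) (lker rho).
have iJ : lie_ideal J by apply: trperp_ideal => //; apply: adr_rep.
have IJ0 x : x \in lker rho -> x \in J -> x = 0.
  move=> xI /mem_trperp xJ; exact: (killing_nondegenerate_ideal char0 ss iI).
have injJ : {in J &, injective rho}.
  move=> x y xJ yJ /eqP; rewrite -subr_eq0 -lfunB -memv_ker => xy.
  by apply/eqP; rewrite -subr_eq0; apply/eqP/IJ0 => //; apply: memvB.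
have nondeg x : x \in J -> (forall y, y \in J -> trform rho x y = 0) -> x = 0.
  move=> xJ xperp; pose J0 := (J :&: trperp rho J)%VS.
  suff J00 : J0 = 0%VS.
    by apply/eqP; rewrite -memv0 -J00 memv_cap xJ; apply/mem_trperp.
  apply: (isotropic_ideal0 char0 ss rep); last 2 first.
  - by move=> y z /memv_capP[yJ _] /memv_capP[zJ _]; apply: injJ.
  - by move=> y z /memv_capP[_ /mem_trperp yI] /memv_capP[zI _]; apply: yI.
  by apply: cap_ideal => //; apply: trperp_ideal.
have [e [e' [trE inv]]] := dual_bases rep iJ nondeg.
exists (\dim J), e, e' => C; split=> // [|x v].
  rewrite linear_sum (eq_bigr (fun=> 1)) /= => [|i _]; last exact: trE.
  rewrite sumr_const card_ord char0_natr_eq0 // dimv_eq0.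
  apply: contraNneq rho0 => J0; rewrite -[rho == 0]/(_ == _).
  have := ideal_complement char0 ss iI; rewrite -/J J0 addv0 => kerT.
  by apply/eqP/lfunP=> x; apply/eqP; rewrite zero_lfunE -memv_ker kerT memvf.
have CE w : C w = \sum_i rho (e i) (rho (e' i) w).
  by rewrite sum_lfunE; apply: eq_bigr => i _; rewrite comp_lfunE.
have Gl z : linear (fun y => rho y (rho z v)).
  by move=> a u w; rewrite lfunD lfunZ add_lfunE scale_lfunE.
have Gr y : linear (fun z => rho y (rho z v)).
  by move=> a u w; rewrite lfunD lfunZ add_lfunE scale_lfunE lfunD lfunZ.
apply/esym/eqP; rewrite -subr_eq0 !CE lfun_sum -sumrB.
rewrite -[X in _ == X](inv V (fun y z => rho y (rho z v)) x Gl Gr).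
by apply/eqP/eq_bigr => i _; rewrite !rep lfunB addrA subrK.
Qed.

Definition cocycle (V : vectType K) (rho : 'Hom(s, 'End(V))) (f : 'Hom(s, V)) :=
  forall x y, f [lie x, y] = rho x (f y) - rho y (f x).

(** The Casimir operator turns a cocycle into a coboundary. *)
Lemma casimir_cocycle (V : vectType K) (rho : 'Hom(s, 'End(V))) (f : 'Hom(s, V))
    n (e e' : 'I_n -> s) :
  cocycle rho f ->
  (forall (W : vectType K) (G : s -> s -> W) y,
      (forall v, linear (G^~ v)) -> (forall u, linear (G u)) ->
      \sum_i (G [lie y, e i] (e' i) + G (e i) [lie y, e' i]) = 0) ->
  lie_rep rho ->
  forall y, (\sum_i (rho (e i) \o rho (e' i))%VF) (f y) = rho y (\sum_i rho (e i) (f (e' i))).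
Proof.
move=> coc inv rep y.
have Gl z : linear (fun y => rho y (f z)).
  by move=> a u w; rewrite lfunD lfunZ add_lfunE scale_lfunE.
have Gr x : linear (fun z => rho x (f z)).
  by move=> a u w; rewrite lfunD lfunZ lfunD lfunZ.
apply/esym/eqP; rewrite -subr_eq0 sum_lfunE lfun_sum -sumrB.
rewrite -[X in _ == X](inv V (fun x z => rho x (f z)) y Gl Gr).
apply/eqP/eq_bigr => i _; rewrite !coc rep lfunB addrA subrK.
by rewrite comp_lfunE.
Qed.

(** Induction on the dimension.  The Casimir operator [C] of a nonzero
representation has nonzero trace, so its generalized kernel [V0] is proper.
Since [C o f] is a coboundary and [C] is invertible on a complement of [V0], [f] becomes
[V0]-valued after subtracting a coboundary. *)
Theorem whitehead (V : vectType K) (rho : 'Hom(s, 'End(V))) (f : 'Hom(s, V)) :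
  lie_rep rho -> cocycle rho f -> exists v, forall x, f x = rho x v.
Proof.
have [n] := ubnP (\dim {:V}); elim: n => // n IHn in V rho f *; rewrite ltnS.
move=> dimV rep coc; have [rho0 | rho0] := eqVneq rho 0.
  exists 0 => x; rewrite lfun0; apply/eqP; rewrite -memv_ker.
  suff /subvP -> : (fullv <= lker f)%VS by rewrite ?memvf.
  rewrite -(semisimple_perfect char0 ss); apply/brackv_subP => y z _ _.
  by rewrite memv_ker coc rho0 !zero_lfunE subrr.
have [m [e [e' [trC Crho inv]]]] := casimir rep rho0.
set C := \sum_i _ in trC Crho; pose w := \sum_i rho (e i) (f (e' i)).
have Cf y : C (f y) = rho y w by apply: casimir_cocycle.
pose V0 : {vspace V} := vspace_of (geig C 0).
have memV0 v : v \in V0 <-> geig C 0 v.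
  by apply: mem_vspace_of => [|a u u']; [apply: geig0 | apply: geig_lin].
have ltV0 : (\dim V0 < n)%N.
  apply: leq_trans dimV; rewrite ltn_neqAle dimvS ?subvf // andbT.
  apply: contraNneq trC => dimE; rewrite ltr_nilp //; apply/lnilp_geig => v.
  apply/memV0; suff -> : V0 = fullv by apply: memvf.
  by apply/eqP; rewrite eqEdim subvf dimE leqnn.
(* split [w] as [C u] plus an element of the generalized kernel of [C] *)
have [u [k Ck]] : exists u k, iter k C (w - C u) = 0.
  apply: (@geig_ind K V {:V} C (fun w => exists u k, iter k C (w - C u) = 0)) (memvf w).
  - by move=> v _; apply: memvf.
  - by exists 0, 0%N; rewrite /= lfun0 subrr.
  - move=> w1 w2 [u1 [k1 E1]] [u2 [k2 E2]]; exists (u1 + u2), (maxn k1 k2).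
    rewrite lfunD opprD addrACA -[w1 - _]scale1r iter_lin.
    by rewrite (iter_lin_le (leq_maxl _ _) E1) (iter_lin_le (leq_maxr _ _) E2) scaler0 addr0.
  move=> c v _ Cv; have [c0|c0] := eqVneq c 0.
    by move: Cv; rewrite c0 => -[k]; rewrite shift0 => E; exists 0, k; rewrite lfun0 subr0.
  have [|u [_ _]] := geig_solve (B := fullv) _ c0 Cv (memvf v).
    by move=> ? _; apply: memvf.
  by rewrite shift0 => E; exists u, 0%N; rewrite /= E subrr.
have fV0 y : f y - rho y u \in V0.
  apply/memV0; exists k.+1; rewrite shift0 iterSr lfunB Cf Crho -lfunB.
  suff -> : iter k C (rho y (w - C u)) = rho y (iter k C (w - C u)) by rewrite Ck lfun0.
  by elim: (k) => //= j ->; rewrite Crho.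
have rhoV0 x v : v \in V0 -> rho x v \in V0.
  by move=> /memV0 Cv; apply/memV0; apply: (geig_morph (h := rho x)) Cv => v'; rewrite Crho.
have [rho' rho'E] : exists rho' : 'Hom(s, 'End(subvs_of V0)),
    forall x v, vsval (rho' x v) = rho x (vsval v).
  have [|r rE] := @lfun_of_linear K s 'End(subvs_of V0) (fun x => restr V0 (rho x)).
    move=> a x y; apply/lfunP=> v; apply: val_inj.
    rewrite /= add_lfunE scale_lfunE /= !restrE; try exact: rhoV0.
    by rewrite lfunD lfunZ add_lfunE scale_lfunE.
  by exists r => x v; rewrite rE restrE //; apply: rhoV0.
have [f' f'E] : exists f' : 'Hom(s, subvs_of V0), forall x, vsval (f' x) = f x - rho x u.
  have [|r rE] := @lfun_of_linear K s (subvs_of V0) (fun x => vsproj V0 (f x - rho x u)).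
    move=> a x y; rewrite -linearP; congr vsproj.
    by rewrite !lfunD !lfunZ add_lfunE scale_lfunE opprD addrACA scalerBr.
  by exists r => x; rewrite rE vsprojK.
have [||| v vE] := IHn (subvs_of V0) rho' f'; rewrite ?dim_subvs //.
- by move=> x y v; apply: val_inj; rewrite /= !rho'E rep.
- move=> x y; apply: val_inj; rewrite /= !(rho'E, f'E) coc rep !lfunB.
  by rewrite !opprB addrACA [RHS]addrACA; congr (_ + _); rewrite addrC.
exists (vsval v + u) => x; rewrite lfunD -rho'E -vE f'E subrK.
by []. Qed.

(** The form used in the sequel: the module is a subquotient [U / U'] of a
representation of [g] on which [ker pi] acts trivially, so that no quotient
module has to appear in a statement.  [U / U'] is realized on a complement [T]
of [U'] in [U]. *)
Theorem whitehead_subquotient (g : lieAlgType K) (pi : 'Hom(g, s)) (W : vectType K)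
    (rho : 'Hom(g, 'End(W))) (U' U : {vspace W}) (f : 'Hom(g, W)) :
  limg pi = fullv -> (forall x y, pi [lie x, y] = [lie pi x, pi y]) ->
  lie_rep rho -> (U' <= U)%VS ->
  (forall x w, w \in U -> rho x w \in U) -> (forall x w, w \in U' -> rho x w \in U') ->
  (forall x w, pi x = 0 -> w \in U -> rho x w \in U') ->
  (forall x, f x \in U) -> (forall x, pi x = 0 -> f x \in U') ->
  (forall x y, f [lie x, y] - (rho x (f y) - rho y (f x)) \in U') ->
  exists u, u \in U /\ forall x, f x - rho x u \in U'.
Proof.
move=> pi_surj pi_hom rep U'U rhoU rhoU' kerU fU kerf coc.
pose T := (U :\: U')%VS.
have TU t : t \in T -> t \in U by apply/subvP/diffvSl.
have [p pE] : exists p : 'Hom(W, subvs_of T), forall w, vsval (p w) = daddv_pi T U' w.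
  exists (linfun (vsproj T) \o daddv_pi T U')%VF => w.
  by rewrite comp_lfunE lfunE /= vsprojK ?memv_pi.
have pT (t : subvs_of T) : p (vsval t) = t.
  by apply: val_inj; rewrite /= pE daddv_pi_id ?subvsP // capv_diff.
have pmod u : u \in U -> u - vsval (p u) \in U'.
  move=> uU; rewrite pE -{1}(@daddv_pi_add _ _ T U' u) ?capv_diff //.
    by rewrite addrC addrA addNr add0r memv_pi.
  by rewrite addv_diff; apply: (subvP (addvSl _ _)).
have p0 u : u \in U' -> p u = 0.
  move=> uU'; apply: val_inj; rewrite /= pE.
  have := @daddv_pi_add _ _ T U' u (capv_diff _ _) (subvP (addvSr _ _) _ uU').
  rewrite (@daddv_pi_id _ _ U' T) //; last by rewrite capvC capv_diff.
  by move/eqP; rewrite -subr_eq0 addrK => /eqP.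
have peq u v : u - v \in U' -> p u = p v.
  by move=> uv; apply/eqP; rewrite -subr_eq0 -lfunB p0.
pose sg : 'Hom(s, g) := (pi^-1)%VF.
have sgK x : pi (sg x) = x by apply: limg_lfunVK; rewrite pi_surj memvf.
have pik x y : pi (sg [lie x, y] - [lie sg x, sg y]) = 0.
  by rewrite lfunB sgK pi_hom !sgK subrr.
have pact x u : u \in U -> p (rho x (vsval (p u))) = p (rho x u).
  by move=> uU; apply: peq; rewrite -lfunB -memvN -lfunN opprB rhoU' ?pmod.
have [r rE] : exists r : 'Hom(s, 'End(subvs_of T)),
    forall x t, r x t = p (rho (sg x) (vsval t)).
  have [|r rE] := @lfun_of_linear K s 'End(subvs_of T)
    (fun x => (p \o rho (sg x) \o linfun vsval)%VF).
    move=> a x y; apply/lfunP=> t.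
    rewrite !(add_lfunE, scale_lfunE, comp_lfunE, lfunD, lfunZ) //.
  exists r => x t; by rewrite rE !comp_lfunE lfunE.
have vU (t : subvs_of T) : vsval t \in U by apply/TU/subvsP.
have r_rep : lie_rep r.
  move=> x y t; rewrite !rE !pact ?rhoU // -lfunB -rep; apply: peq.
  by rewrite -opp_lfunE -add_lfunE -lfunB kerU.
have [|v vE] := @whitehead (subvs_of T) r (p \o f \o sg)%VF r_rep.
  move=> x y; rewrite !comp_lfunE !rE !pact // -lfunB.
  rewrite (peq _ (f [lie sg x, sg y])); last by rewrite -lfunB kerf.
  exact/peq/coc.
exists (vsval v); split=> // x.
have [d [d0 xd]] : exists d, pi d = 0 /\ x = d + sg (pi x).
  by exists (x - sg (pi x)); rewrite lfunB sgK subrr subrK.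
rewrite {1 2}xd !lfunD add_lfunE opprD addrACA.
apply: memvD; first by rewrite memvB ?kerf ?kerU.
set u := f _ - _; have uU : u \in U by rewrite memvB ?rhoU.
have := pmod u uU; suff -> : p u = 0 by rewrite subr0.
by have := vE (pi x); rewrite !comp_lfunE rE => E; rewrite lfunB E subrr.
Qed.

End Whitehead.

(** * The quotient by the radical *)

Section Quotient.

Context {K : fieldType}.

(** The carrier is a complement of [I], with the bracket of [g] projected onto it. *)
Lemma quotient_exists (g : lieAlgType K) (I : {vspace g}) : lie_ideal I ->
  exists (s : lieAlgType K) (pi : 'Hom(g, s)),
  [/\ limg pi = fullv, lker pi = I & forall x y, pi [lie x, y] = [lie pi x, pi y]].
Proof.
move=> iI; pose T := (I^C)%VS; pose W : vectType K := subvs_of T.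
have TI0 : (T :&: I = 0)%VS by rewrite capvC capv_compl.
have [p pE] : exists p : 'Hom(g, W), forall w, vsval (p w) = daddv_pi T I w.
  exists (linfun (vsproj T) \o daddv_pi T I)%VF => w.
  by rewrite comp_lfunE lfunE /= vsprojK ?memv_pi.
have pT (t : W) : p (vsval t) = t.
  by apply: val_inj; rewrite /= pE daddv_pi_id ?subvsP.
have pmod u : u - vsval (p u) \in I.
  rewrite pE -{1}(@daddv_pi_add _ _ T I u) //; last by rewrite addvC addv_complf memvf.
  by rewrite addrC addrA addNr add0r memv_pi.
have p0 u : u \in I -> p u = 0.
  move=> uI; apply: val_inj; rewrite /= pE.
  have := @daddv_pi_add _ _ T I u TI0 (subvP (addvSr _ _) _ uI).
  rewrite (@daddv_pi_id _ _ I T) //; last by rewrite capvC.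
  by move/eqP; rewrite -subr_eq0 addrK => /eqP.
have peq u v : u - v \in I -> p u = p v.
  by move=> uv; apply/eqP; rewrite -subr_eq0 -lfunB p0.
pose br (x y : W) : W := p [lie vsval x, vsval y].
have brE u v : br (p u) (p v) = p [lie u, v].
  apply: peq; rewrite -[X in X - _]opprK -memvN opprD !opprK.
  have -> : - [lie vsval (p u), vsval (p v)] + [lie u, v] =
      [lie u - vsval (p u), v] + [lie vsval (p u), v - vsval (p v)].
    by rewrite brackBl brackBr addrA subrK addrC.
  by rewrite memvD //; [rewrite brackC memvN iI | rewrite iI].
have brl a x y z : br (a *: x + y) z = a *: br x z + br y z.
  by rewrite /br -lfunZ -lfunD linearP brackDl brackZl.
have brr a x y z : br x (a *: y + z) = a *: br x y + br x z.
  by rewrite /br -lfunZ -lfunD !linearP.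
have brxx x : br x x = 0 by rewrite /br bracketxx lfun0.
have brJ x y z : br x (br y z) + br y (br z x) + br z (br x y) = 0.
  by rewrite -[x]pT -[y]pT -[z]pT !brE -!lfunD jacobi lfun0.
pose m := isLieAlgebra.Build K W brl brr brxx brJ.
pose s : lieAlgType K := HB.pack W m.
exists s, p; split.
- apply/eqP; rewrite eqEsubv subvf; apply/subvP=> t _.
  by rewrite -[t]pT memv_img ?memvf.
- apply/vspaceP=> u; rewrite memv_ker; apply/eqP/idP => [u0|/p0//].
  by have := pmod u; rewrite u0 subr0.
- by move=> x y; rewrite -brE.
Qed.

Lemma radical_quotient_semisimple (g s : lieAlgType K) (pi : 'Hom(g, s)) (R : {vspace g}) :
  is_radical R -> limg pi = fullv -> lker pi = R ->
  (forall x y, pi [lie x, y] = [lie pi x, pi y]) -> lie_semisimple s.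
Proof.
move=> [iR [n solR] maxR] pi_surj kerpi pi_hom I iI abI.
pose J := (pi @^-1: I)%VS.
have iJ : lie_ideal J by move=> x y; rewrite -!memv_preim pi_hom; apply: iI.
have solJ : lie_solvable J.
  exists (1 + n)%N; apply/eqP; rewrite -subv0 derived_series_add -solR derived_seriesS //=.
  apply/brackv_subP => x y; rewrite -!memv_preim => xJ yJ; rewrite -kerpi memv_ker pi_hom.
  by rewrite -memv0 -abI memv_brack.
have /subvP JR := maxR _ iJ solJ.
apply/eqP; rewrite -subv0; apply/subvP=> y yI.
have /memv_imgP[x _ yE] : y \in limg pi by rewrite pi_surj memvf.
have : x \in J by rewrite -memv_preim -yE.
by move=> /JR; rewrite -kerpi memv_ker -yE memv0.
Qed.

End Quotient.

(** * Jordan decomposition in a semisimple algebra *)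

Section CartanSubalgebra.

Context {K : closedFieldType}.
Hypothesis char0 : [pchar K] =i pred0.
Variable s : lieAlgType K.
Hypothesis ss : lie_semisimple s.

Lemma derivation_inner (d : 'End(s)) : is_derivation d ->
  exists v, forall x, d x = [lie v, x].
Proof.
move=> der; have [|v vE] := whitehead char0 ss (@adr_rep K s) (f := d).
  by move=> x y; rewrite der !adrE addrC (brackC (d x)).
by exists (- v) => x; rewrite vE adrE brackNl -brackC.
Qed.

Lemma geig_bracket (x : s) c d y z :
  geig (ad x) c y -> geig (ad x) d z -> geig (ad x) (c + d) [lie y, z].
Proof.
apply: (geig_bilinear (B := fun y z => [lie y, z])) => [v a u w|v a u w|u v].
- by rewrite brackDl brackZl.
- by rewrite brackDr brackZr.
- by rewrite !adE brackJ.
Qed.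

Definition ss_part (x y : s) := forall c z, geig (ad x) c z -> [lie y, z] = c *: z.

(** The semisimple part of [ad x] is a derivation because weights add up under the
bracket, and derivations are inner. *)
Lemma ss_part_exists x : exists y, ss_part x y.
Proof.
have [r [n [S [_ _ _ SE _]]]] := spectral_function (ad x).
have [|y yE] := derivation_inner (d := S id); last first.
  by exists y => c z xz; rewrite -yE (SE id c).
move=> u v.
apply: (@geig_ind K s {:s} (ad x)
  (fun u => S id [lie u, v] = [lie S id u, v] + [lie u, S id v])) (memvf u).
- by move=> w _; apply: memvf.
- by rewrite brack0l !lfun0 !brack0l addr0.
- by move=> a b; rewrite brackDl !lfunD !brackDl => -> ->; rewrite addrACA.
move=> c a _ xa.
apply: (@geig_ind K s {:s} (ad x)
  (fun v => S id [lie a, v] = [lie S id a, v] + [lie a, S id v])) (memvf v).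
- by move=> w _; apply: memvf.
- by rewrite brack0r !lfun0 !brack0r addr0.
- by move=> b b'; rewrite brackDr !lfunD !brackDr => -> ->; rewrite addrACA.
move=> d b _ xb; rewrite (SE id c a) // (SE id d b) // (SE id (c + d)); last exact: geig_bracket.
by rewrite brackZl brackZr scalerDl.
Qed.

Lemma ss_part_semisimple x y : ss_part x y -> semisimple_op (ad y).
Proof.
move=> xy; apply: semisimple_opP => Q Q0 QD Qe v.
apply: (@geig_ind K s {:s} (ad x) Q) (memvf v) => //; first by move=> w _; apply: memvf.
by move=> c w _ xw; apply: (Qe c); rewrite adE; apply: xy.
Qed.

Lemma ss_part_comm x y z : ss_part x y -> [lie x, z] = 0 -> [lie y, z] = 0.
Proof.
by move=> xy xz; rewrite (xy 0) ?scale0r //; apply: geig_eig; rewrite adE xz scale0r.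
Qed.

Lemma nil_part x y : ss_part x y -> lnilp (ad (x - y)).
Proof.
move=> xy; apply/lnilp_geig => v.
apply: (@geig_ind K s {:s} (ad x) (geig (ad (x - y)) 0)) (memvf v).
- by move=> w _; apply: memvf.
- exact: geig0.
- by move=> u w; apply: geigD.
move=> c w _ xw; have [n E] := xw; exists n; rewrite shift0.
suff -> : iter n (ad (x - y)) w = iter n (shift (ad x) c) w by [].
elim: n {E} => //= n ->; rewrite adE brackBl shiftE adE; congr (_ - _).
by apply: xy; elim: n => //= n; apply: geig_shift.
Qed.

Lemma killing_nilp_comm (x y : s) : lnilp (ad x) -> [lie x, y] = 0 -> killing x y = 0.
Proof.
move=> nilx xy; apply: ltr_nilp => v; have [n xn] := nilx v; exists n.
have comm w : ad x (ad y w) = ad y (ad x w) by rewrite !adE brackJ xy brack0l add0r.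
have comm_n k w : iter k (ad x) (ad y w) = ad y (iter k (ad x) w).
  by elim: k => //= k ->; rewrite comm.
suff E k w : iter k (adr x \o adr y)%VF w = iter k (ad y) (iter k (ad x) w).
  by rewrite E xn iter_lin0.
elim: k w => // k IHk w; rewrite iterSr IHk comp_lfunE !adrE -!adE.
by rewrite -iterSr comm_n -iterSr.
Qed.

End CartanSubalgebra.

(** * Cartan subalgebras *)

Section Cartan.

Context {K : closedFieldType}.
Hypothesis char0 : [pchar K] =i pred0.
Variable s : lieAlgType K.
Hypothesis ss : lie_semisimple s.
Implicit Types (h x y z u v w : s).

Definition eigenvalues_of (h : s) (r : seq K) :=
  uniq r /\ forall c, c \in r -> exists v, v != 0 /\ [lie h, v] = c *: v.

Lemma most_eigenvalues : exists h r, [/\ semisimple_op (ad h), eigenvalues_of h r &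
  forall h' r', semisimple_op (ad h') -> eigenvalues_of h' r' -> (size r' <= size r)%N].
Proof.
pose P n := `[< exists h r, [/\ semisimple_op (ad h), eigenvalues_of h r & size r = n] >].
have exP : exists n, P n.
  exists 0%N; apply/asboolP; exists 0, [::]; split=> //.
  apply: semisimple_opP => Q Q0 QD Qe v; apply: (Qe 0).
  by rewrite adE brack0l scale0r.
have ubP n : P n -> (n <= \dim {:s})%N.
  move=> /asboolP[h [r [_ [ur rP] <-]]]; apply: (@eigenvalues_bound K s (ad h)) => // c.
  by move=> /rP[v [v0 hv]]; exists v; rewrite adE.
case: (ex_maxnP exP ubP) => n /asboolP[h [r [ssh rP <-]]] maxr.
exists h, r; split=> // h' r' ssh' r'P; apply: maxr; apply/asboolP; by exists h', r'.
Qed.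

Definition eigsp (h : s) c : {vspace s} := lker (shift (ad h) c).

Lemma mem_eigsp h c v : (v \in eigsp h c) = ([lie h, v] == c *: v).
Proof. by rewrite memv_ker shiftE adE subr_eq0. Qed.

Lemma eigsp_stable h z c v : [lie h, z] = 0 -> v \in eigsp h c -> [lie z, v] \in eigsp h c.
Proof.
move=> hz; rewrite !mem_eigsp => /eqP hv.
by rewrite brackJ hz brack0l add0r hv brackZr.
Qed.

Lemma eigsp_brack h c d u v :
  u \in eigsp h c -> v \in eigsp h d -> [lie u, v] \in eigsp h (c + d).
Proof.
rewrite !mem_eigsp => /eqP hu /eqP hv.
by rewrite brackJ hu hv brackZl brackZr scalerDl.
Qed.

Lemma semisimple_ind h (Q : s -> Prop) : semisimple_op (ad h) -> Q 0 ->
  (forall u v, Q u -> Q v -> Q (u + v)) ->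
  (forall c v, v \in eigsp h c -> Q v) -> forall v, Q v.
Proof.
move=> ssh Q0 QD Qe v; apply: (@geig_ind K s {:s} (ad h) Q) (memvf v) => //.
  by move=> w _; apply: memvf.
by move=> c w _ hw; apply: (Qe c); rewrite mem_eigsp -adE (ssh _ _ hw).
Qed.

Lemma semisimple_comm_add h z t : semisimple_op (ad h) -> semisimple_op (ad z) ->
  [lie h, z] = 0 -> semisimple_op (ad (h + t *: z)).
Proof.
move=> ssh ssz hz; apply: semisimple_opP => Q Q0 QD Qe.
apply: (semisimple_ind ssh) => // c v vc.
apply: (@geig_ind K s (eigsp h c) (ad z) Q) vc => // [u uc|b u uc zu].
  by rewrite adE; apply: eigsp_stable.
apply: (Qe (c + t * b)); rewrite adE brackDl brackZl -(adE z) (ssz _ _ zu).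
by move: uc; rewrite mem_eigsp => /eqP->; rewrite scalerDl scalerA.
Qed.

(** Two of these values coincide for at most one [t]. *)
Lemma generic_combination (L : seq (K * K)) : uniq L ->
  exists t, uniq [seq p.1 + t * p.2 | p <- L].
Proof.
move=> uL; pose bad := [seq (q.1 - p.1) / (p.2 - q.2) | p <- L, q <- L].
have [t tbad] := avoid_finite bad char0; exists t.
rewrite map_inj_in_uniq // => -[c b] [d e] pL qL /= E.
have [be|be] := eqVneq b e; first by move: E; rewrite be => /addIr->.
exfalso; move/negP: tbad; apply; apply/allpairsP; exists ((c, b), (d, e)); split=> //=.
apply: (mulIf (x := b - e)); first by rewrite subr_eq0.
rewrite divfK ?subr_eq0 // mulrBr; have -> : t * b = d + t * e - c by rewrite -E addrC addKr.
by rewrite addrAC addrK.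
Qed.

Section MaxElement.

Variables (h : s) (r : seq K).
Hypotheses (ssh : semisimple_op (ad h)) (rP : eigenvalues_of h r).
Hypothesis maxr : forall h' r', semisimple_op (ad h') -> eigenvalues_of h' r' ->
  (size r' <= size r)%N.

(** If [z] had two distinct eigenvalues on some eigenspace of [h], a generic
[h + t z] would have more eigenvalues than [h]. *)
Lemma max_scalar z c : semisimple_op (ad z) -> [lie h, z] = 0 ->
  exists b, forall v, v \in eigsp h c -> [lie z, v] = b *: v.
Proof.
move=> ssz hz; have [E0 | E0] := eqVneq (eigsp h c) 0%VS.
  by exists 0 => v; rewrite E0 memv0 => /eqP->; rewrite brack0r scaler0.
have st d v : v \in eigsp h d -> ad z v \in eigsp h d.
  by rewrite adE; apply: eigsp_stable.
have [b [w [wc w0 zw]]] := eigenvector (st c) E0.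
have ex_b d : exists e, d \in r ->
    exists v, [/\ v != 0, v \in eigsp h d & [lie z, v] = e *: v].
  have [->|dc] := eqVneq d c; first by exists b => _; exists w; rewrite -adE.
  have [Ed0 | Ed0] := eqVneq (eigsp h d) 0%VS; last first.
    by have [e [v [vd v0 zv]]] := eigenvector (st d) Ed0; exists e => _; exists v; rewrite -adE.
  exists 0 => /(rP.2 d)[v [v0 hv]]; case/negP: v0.
  by rewrite -memv0 -Ed0 mem_eigsp hv.
have {}[be beP] := choice ex_b.
exists (be c) => v; apply: (@geig_ind K s (eigsp h c) (ad z)
  (fun v => [lie z, v] = be c *: v) (st c)).
- by rewrite brack0r scaler0.
- by move=> u u'; rewrite brackDr scalerDr => -> ->.
move=> e u uc zu; have zue : [lie z, u] = e *: u by rewrite -adE; apply: ssz.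
have [ebc|ebc] := eqVneq e (be c); first by rewrite -ebc.
have [u0|u0] := eqVneq u 0; first by rewrite u0 brack0r scaler0.
(* [L] lists pairs of joint eigenvalues of [h] and [z]: one for each element of [r],
and a second one over [c] *)
exfalso; pose L := (c, e) :: [seq (d, be d) | d <- r].
have uL : uniq L.
  rewrite /= map_inj_uniq ?rP.1 ?andbT; last by move=> d d' [].
  by apply/mapP => -[d _ [cd]]; rewrite -cd => E; rewrite E eqxx in ebc.
have [t ut] := generic_combination uL.
have : (size [seq (p.1 + t * p.2)%R | p <- L] <= size r)%N.
  apply: (@maxr (h + t *: z)); first exact: semisimple_comm_add.
  split=> // _ /mapP[[d e'] + ->] /=; rewrite inE => /predU1P[[-> ->]|/mapP[d' d'r [-> ->]]].
    exists u; split=> //; move: uc; rewrite mem_eigsp => /eqP hu.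
    by rewrite brackDl brackZl hu zue scalerDl scalerA.
  have [v' [v'0 + zv]] := beP _ d'r; rewrite mem_eigsp => /eqP hv.
  by exists v'; split=> //; rewrite brackDl brackZl hv zv scalerDl scalerA.
by rewrite size_map /= size_map ltnn.
Qed.

Let C := eigsp h 0.

Lemma mem_centralizer x : x \in C <-> [lie h, x] = 0.
Proof. by rewrite mem_eigsp scale0r; split=> /eqP. Qed.

Lemma centralizer_subalg : lie_subalg C.
Proof. by move=> x y /mem_centralizer hx yC; apply: eigsp_stable. Qed.

(** By [max_scalar], [y] acts as a scalar on the centralizer [C] of [h]; since [y]
belongs to [C] and commutes with itself, the scalar is zero unless [y = 0]. *)
Lemma centralizer_ss_part x y : x \in C -> ss_part x y -> y \in C /\ forall z, z \in C -> [lie y, z] = 0.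
Proof.
move=> /mem_centralizer hx xy.
have yh : [lie y, h] = 0 by apply: (ss_part_comm xy); rewrite brackC hx oppr0.
have yC : y \in C by apply/mem_centralizer; rewrite brackC yh oppr0.
split=> // z zC; have [|b bE] := max_scalar 0 (ss_part_semisimple xy); first exact/mem_centralizer.
have [->|y0] := eqVneq y 0; first by rewrite brack0l.
have := bE _ yC; rewrite bracketxx => /esym/eqP; rewrite scaler_eq0 (negPf y0) orbF => /eqP b0.
by rewrite bE // b0 scale0r.
Qed.

Lemma killing_eigsp c d u v : u \in eigsp h c -> v \in eigsp h d -> c + d != 0 ->
  killing u v = 0.
Proof.
rewrite !mem_eigsp => /eqP hu /eqP hv cd0.
have := trform_invN (@adr_rep K s) u h v; rewrite hu hv.
rewrite trformC !trformZ => /eqP; rewrite -subr_eq0 opprK trformC -mulrDl.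
by rewrite mulf_eq0 (negPf cd0) => /eqP.
Qed.

Lemma centralizer_nondegenerate x : x \in C -> (forall y, y \in C -> killing x y = 0) -> x = 0.
Proof.
move=> xC xperp; apply: (killing_nondegenerate char0 ss).
apply: (semisimple_ind ssh) => [|u v|c v vc].
- exact: trform0.
- by rewrite /killing trformD => -> ->; rewrite addr0.
have [c0|c0] := eqVneq c 0; first by rewrite c0 in vc; apply: xperp.
by apply: (killing_eigsp xC vc); rewrite add0r.
Qed.

(** Semisimple parts are central in [C], so every element of [C] is ad-nilpotent on
[C].  For [w] in the centre [Z], the nilpotent part of [w] commutes with [C], so it is
orthogonal to [C], hence zero.  If [C <> Z], Engel's theorem yields [w] in [C] but not
in [Z] with [[C, w]] contained in [Z]; splitting [u] in [C] into its semisimple and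
nilpotent parts, [killing [u, w] z = killing u [w, z]] vanishes for both,
so [[u, w] = 0] for all [u], a contradiction. *)
Lemma centralizer_toral x : x \in C ->
  semisimple_op (ad x) /\ forall y, y \in C -> [lie x, y] = 0.
Proof.
pose Z : {vspace s} := vspace_of (fun w => w \in C /\ forall y, y \in C -> [lie y, w] = 0).
have memZ w : w \in Z <-> (w \in C /\ forall y, y \in C -> [lie y, w] = 0).
  apply: mem_vspace_of => [|a u v [uC uZ] [vC vZ]].
    by split=> [|y _]; [apply: mem0v | apply: brack0r].
  split=> [|y yC]; first by rewrite memvD ?memvZ.
  by rewrite brackDr brackZr uZ // vZ // scaler0 addr0.
have nilC u y : u \in C -> ss_part u y -> forall v, exists n, iter n (ad (u - y)) v = 0.
  by move=> _; apply: nil_part.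
have Z_ss w : w \in Z -> semisimple_op (ad w).
  move=> /memZ[wC wZ]; have [y wy] := ss_part_exists char0 ss w.
  have [yC yZ] := centralizer_ss_part wC wy.
  suff -> : w = y by apply: ss_part_semisimple wy.
  apply/eqP; rewrite -subr_eq0; apply/eqP/centralizer_nondegenerate => [|z zC]; first by rewrite memvB.
  apply: killing_nilp_comm; first exact: nil_part.
  by rewrite brackBl yZ // subr0 brackC wZ // oppr0.
suff CZ : (C <= Z)%VS.
  move=> xC; have /memZ[_ xZ] := subvP CZ _ xC; split; first exact/Z_ss/(subvP CZ).
  by move=> y yC; rewrite brackC xZ // oppr0.
apply: contraT => neqCZ.
have adnil u w : u \in C -> w \in C -> exists n, iter n (ad u) w = 0.
  move=> uC wC; have [y uy] := ss_part_exists char0 ss u; have [yC yZ] := centralizer_ss_part uC uy.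
  have [n E] := nil_part uy w; exists n.
  suff [<- _] : iter n (ad (u - y)) w = iter n (ad u) w /\ iter n (ad u) w \in C by [].
  elim: n {E} => //= n [-> IC]; rewrite !adE; split; last exact: centralizer_subalg.
  by rewrite brackBl (yZ _ IC) subr0.
have stZ u w : u \in C -> w \in Z -> [lie u, w] \in Z.
  by move=> uC /memZ[_ wZ]; rewrite wZ // mem0v.
have [w [wC wZ Cw]] := engel centralizer_subalg adnil adnil stZ centralizer_subalg neqCZ.
case/negP: wZ; apply/memZ; split=> // u uC; apply: centralizer_nondegenerate => [|z zC].
  exact: centralizer_subalg.
rewrite /killing trform_inv; last exact: adr_rep.
have [y uy] := ss_part_exists char0 ss u; have [yC yZ] := centralizer_ss_part uC uy.
have /memZ[zwC zwZ] := Cw z zC.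
(* [u - y] is the nilpotent part of [u]: it commutes with [[w, z]], and the
semisimple part [y] commutes with [w] *)
rewrite -[u](subrK y) trformC trformD [X in X + _]trformC [X in _ + X]trformC.
rewrite [X in X + _]killing_nilp_comm ?add0r; last first.
- by rewrite (brackC w z) brackNr zwZ ?oppr0 // memvB.
- exact: nil_part.
rewrite -trform_inv; last exact: adr_rep.
by rewrite yZ // trformC trform0.
Qed.

End MaxElement.

Theorem cartan_subalgebra : exists h : s,
  [/\ semisimple_op (ad h),
      (forall x y, x \in eigsp h 0 -> y \in eigsp h 0 -> [lie x, y] = 0) &
      (forall x c, x \in eigsp h 0 ->
         exists b, forall v, v \in eigsp h c -> [lie x, v] = b *: v)].
Proof.
have [h [r [ssh rP maxr]]] := most_eigenvalues; exists h.
have CE := centralizer_toral ssh rP maxr.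
split=> // [x y xC yC|x c xC]; first by apply: (CE x xC).2.
by apply: (max_scalar ssh rP maxr) (CE x xC).1 _; apply/mem_centralizer.
Qed.

End Cartan.

(** * A principal element *)

Section Principal.

Context {K : closedFieldType}.
Hypothesis char0 : [pchar K] =i pred0.
Variable s : lieAlgType K.
Hypothesis ss : lie_semisimple s.
Implicit Types (h x y z u v w : s).

Lemma ltn_count (T : eqType) (a b : pred T) (r : seq T) (x : T) :
  subpred a b -> x \in r -> b x -> ~~ a x -> (count a r < count b r)%N.
Proof.
move=> ab xr bx nax; elim: r xr => //= y r IHr; rewrite inE => /predU1P[<-|/IHr lt_r].
  by rewrite bx (negPf nax) add0n add1n ltnS sub_count.
by rewrite -addnS leq_add //; case: (a y) (ab y) => // ->.
Qed.

(** Let [H] be the centralizer of [h], which acts on the eigenspace of weight [c] by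
the functional [al c].  Order the roots by the sign of [F] and call a positive
root simple if its functional is not the sum of two positive ones.  The
difference of two distinct simple roots is not a root, so for [e c] and [f c] dual
root vectors, [x = \sum_c e c] over the simple roots satisfies
[[x, f c] = [e c, f c]], an element of [H] that represents [al c] for the Killing form.  If
[[x, y] = 0], the [H]-component [y0] of [y] then has
[al c y0 = killing y [x, f c] = 0] for every simple [c], hence for every
root, so [y0] is central and vanishes. *)
Theorem principal_element : exists h (F : K -> rat) (r : seq K) (e : K -> s),
  [/\ semisimple_op (ad h), Qlinear F,
      (forall c, c \in r -> e c \in eigsp h c /\ 0 < F c) &
      forall y, [lie \sum_(c <- r) e c, y] = 0 -> exists (r' : seq K) (w : K -> s),
        (forall c, c \in r' -> c != 0 /\ w c \in eigsp h c) /\ y = \sum_(c <- r') w c].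
Proof.
have [h [ssh Ccomm Cscal]] := cartan_subalgebra char0 ss; exists h.
have hC : h \in eigsp h 0 by rewrite mem_eigsp bracketxx scale0r.
have [al alE] : exists al : K -> s -> K, forall c z v, z \in eigsp h 0 ->
    v \in eigsp h c -> [lie z, v] = al c z *: v.
  have [|al alE] := @choice (K * s)%type K (fun p b => p.2 \in eigsp h 0 ->
    forall v, v \in eigsp h p.1 -> [lie p.2, v] = b *: v).
    move=> [c z] /=; have [zC|zC] := boolP (z \in eigsp h 0); last by exists 0.
    by have [b bE] := Cscal z c zC; exists b.
  by exists (fun c z => al (c, z)) => c z v zC vc; apply: (alE (c, z)).
have [R0 [p [[uR0 _] gp pE p1 p0]]] := geig_projectors (ad h).
have peig c v : p c v \in eigsp h c by rewrite mem_eigsp -adE (ssh _ _ (gp c v)).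
have geigP c v : v \in eigsp h c -> geig (ad h) c v.
  by rewrite mem_eigsp -adE => /eqP; apply: geig_eig.
pose root c := c != 0 /\ exists v, v != 0 /\ v \in eigsp h c.
have rootR c : root c -> c \in R0.
  move=> [_ [v [v0 vc]]]; apply: contraNT v0 => cR; rewrite [v]pE big_seq big1 // => d dR.
  by apply: (p0 c); [apply: contraNneq cR => -> | apply: geigP].
have [F [FL Fn0]] := Qlinear_nonvanishing char0 R0; exists F.
have Froot c : root c -> F c != 0 by move=> rc; apply: Fn0; [apply: rootR | case: rc].
have kneg c d u v : u \in eigsp h c -> v \in eigsp h d -> c + d != 0 -> killing u v = 0.
  exact: killing_eigsp.
have dual c : root c -> exists e f, [/\ e \in eigsp h c, f \in eigsp h (- c) & killing e f = 1].
  move=> [c0 [v [v0 vc]]].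
  have [y [yc vy]] : exists y, y \in eigsp h (- c) /\ killing v y != 0.
    apply: contrapT => ny; case/negP: v0; apply/eqP/(killing_nondegenerate char0 ss).
    apply: (semisimple_ind ssh) => [|u u' E E'|d u ud].
    - exact: trform0.
    - by rewrite /killing trformD [trform _ _ u]E [trform _ _ u']E' addr0.
    have [dc|dc] := eqVneq (c + d) 0; last exact: (kneg c d).
    apply: contrapT => /eqP vu; apply: ny; exists u; split=> //.
    by have -> : - c = d by apply/eqP; rewrite eq_sym -addr_eq0 addrC dc.
  exists v, ((killing v y)^-1 *: y); split=> //; first exact: memvZ.
  by rewrite /killing trformZ mulVf.
have [e [f efP]] : exists e f : K -> s, forall c, root c ->
    [/\ e c \in eigsp h c, f c \in eigsp h (- c) & killing (e c) (f c) = 1].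
  have [|ef efE] := @choice K (s * s)%type (fun c q => root c ->
    [/\ q.1 \in eigsp h c, q.2 \in eigsp h (- c) & killing q.1 q.2 = 1]).
    move=> c; have [rc|nrc] := pselect (root c); last by exists (0, 0).
    by have [u [v uv]] := dual c rc; exists (u, v).
  by exists (fun c => (ef c).1), (fun c => (ef c).2) => c rc; apply: efE.
have neq0 u v : killing u v = 1 -> v != 0.
  by move=> uv; apply: contra_eq_neq uv => ->; rewrite /killing trform0 eq_sym oner_eq0.
have rootN c : root c -> root (- c).
  move=> rc; have [ec fc ef1] := efP c rc; split; first by rewrite oppr_eq0; case: rc.
  by exists (f c); rewrite (neq0 _ _ ef1).
have al_ef c z : root c -> z \in eigsp h 0 -> al c z = killing z [lie e c, f c].
  move=> rc zC; have [ec fc ef1] := efP c rc.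
  rewrite /killing -trform_inv; last exact: adr_rep.
  by rewrite (alE _ _ _ zC ec) trformC trformZ trformC [trform _ _ _]ef1 mulr1.
have alN c z : root c -> z \in eigsp h 0 -> al (- c) z = - al c z.
  move=> rc zC; have [ec fc ef1] := efP c rc.
  have := trform_invN (@adr_rep K s) (e c) z (f c).
  rewrite (alE _ _ _ zC ec) (alE _ _ _ zC fc) trformC !trformZ trformC.
  by rewrite [trform _ _ _]ef1 !mulr1 => ->; rewrite opprK.
have alh c : root c -> al c h = c.
  move=> [_ [v [v0 vc]]]; have := alE c h v hC vc.
  move: vc; rewrite mem_eigsp => /eqP-> /eqP; rewrite -subr_eq0 -scalerBl scaler_eq0.
  by rewrite (negPf v0) orbF subr_eq0 => /eqP.
pose pos c := root c /\ 0 < F c.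
(* equality of functionals on the centralizer of [h], not only of their values at [h] *)
pose decomposable c := exists c1 c2, [/\ pos c1, pos c2 &
  forall z, z \in eigsp h 0 -> al c z = al c1 z + al c2 z].
pose D := [seq c <- R0 | `[< pos c /\ ~ decomposable c >]].
have DP c : c \in D <-> pos c /\ ~ decomposable c.
  rewrite mem_filter; split=> [/andP[/asboolP//]|cD].
  by apply/andP; split; [apply/asboolP | apply: rootR; case: cD => -[]].
exists D, e; split=> // [c /DP[[rc Fc] _]|y xy]; first by have [ec _ _] := efP c rc.
have cross c d : c \in D -> d \in D -> c != d -> [lie e c, f d] = 0.
  move=> /DP[[rc Fc] nc] /DP[[rd Fd] nd] cd.
  have [ec _ _] := efP c rc; have [_ fd _] := efP d rd.
  apply/eqP; apply: contraT => u0; exfalso; set u := [lie e c, f d] in u0.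
  have uq : u \in eigsp h (c - d) by apply: eigsp_brack.
  have rq : root (c - d) by split; [rewrite subr_eq0 | exists u].
  have alq z : z \in eigsp h 0 -> al (c - d) z = al c z - al d z.
    move=> zC; have := alE _ _ _ zC uq; rewrite {1}/u brackJ (alE _ _ _ zC ec).
    rewrite (alE _ _ _ zC fd) alN // brackZl brackZr -scalerDl -/u => /eqP.
    by rewrite -subr_eq0 -scalerBl scaler_eq0 (negPf u0) orbF subr_eq0 => /eqP.
  have := Froot _ rq; rewrite neq_lt => /orP[Fq|Fq].
    apply: nd; exists (- (c - d)), c; split=> // [|z zC].
      by split; [apply: rootN | rewrite (QlinearN char0) // oppr_gt0].
    by rewrite alN // alq // opprB subrK.
  apply: nc; exists (c - d), d; split=> // z zC.
  by rewrite alq // subrK.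
have [y0 y0E] : exists y0, y0 = p 0 y by exists (p 0 y).
have y0C : y0 \in eigsp h 0 by rewrite y0E; apply: peig.
(* weight spaces of nonopposite weights are orthogonal *)
have ky0 v : v \in eigsp h 0 -> killing y v = killing y0 v.
  move=> vC; rewrite {1}[y]pE /killing trformC trform_sum.
  rewrite (bigID (fun c => c == 0)) /= [X in _ + X]big1 ?addr0 => [|c c0]; last first.
    by rewrite trformC; apply: (kneg c 0); rewrite ?addr0.
  have [R00|R00] := boolP (0 \in R0).
    by rewrite -big_filter filter_pred1_uniq // big_seq1 trformC y0E.
  rewrite big_seq_cond big1 => [|c /andP[cR /eqP c0]]; last by rewrite -c0 cR in R00.
  have -> : y0 = 0.
    rewrite [y0]pE big_seq big1 // => c cR.
    by apply: (p0 0); [apply: contraNneq R00 => -> | apply: geigP].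
  by rewrite trformC trform0.
have al_simple c : c \in D -> al c y0 = 0.
  move=> cD; have [[rc Fc] nc] := (DP c).1 cD; have [ec fc ef1] := efP c rc.
  have efC : [lie e c, f c] \in eigsp h 0 by rewrite -(subrr c); apply: eigsp_brack.
  rewrite al_ef // -ky0 //.
  have <- : [lie \sum_(d <- D) e d, f c] = [lie e c, f c].
    rewrite brack_suml (bigD1_seq c) ?filter_uniq //= big_seq_cond big1 ?addr0 // => d /andP[dD dc].
    exact: cross.
  rewrite /killing -trform_inv; last exact: adr_rep.
  by rewrite brackC xy oppr0 trformC trform0.
(* induction on the number of roots below [c] *)
have al_pos c : pos c -> al c y0 = 0.
  have [n] := ubnP (count (fun d => F d < F c) R0).
  elim: n c => // n IHn c; rewrite ltnS => le_n pc.
  have [dec|ndec] := pselect (decomposable c); last by apply/al_simple/DP.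
  have [c1 [c2 [pc1 pc2 alc]]] := dec; rewrite alc //.
  have cE : c = c1 + c2.
    by have := alc h hC; rewrite (alh c pc.1) (alh c1 pc1.1) (alh c2 pc2.1).
  have lt_count d : pos d -> F d < F c -> (count (fun b => (F b < F d)%R) R0 < n)%N.
    move=> [rd _] Fdc; apply: leq_trans le_n; apply: (ltn_count (x := d)) => //.
    - by move=> b Fb; apply: lt_trans Fdc.
    - exact: rootR.
    - by rewrite ltxx.
  have [[r1 F1] [r2 F2]] := (pc1, pc2).
  rewrite (IHn c1) ?(IHn c2) ?addr0 //; apply: lt_count => //.
    by rewrite cE (QlinearD char0) // ltrDr.
  by rewrite cE (QlinearD char0) // ltrDl.
have al_root c : root c -> al c y0 = 0.
  move=> rc; have := Froot _ rc; rewrite neq_lt => /orP[Fc|Fc]; last exact: al_pos.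
  rewrite -[c]opprK alN ?al_pos ?oppr0 //; last exact: rootN.
  by split; [apply: rootN | rewrite (QlinearN char0) // oppr_gt0].
have y00 : y0 = 0.
  apply: (semisimple_center0 ss) => z; rewrite brackC; apply/eqP; rewrite oppr_eq0; apply/eqP.
  apply: (semisimple_ind (Q := fun z => [lie y0, z] = 0) ssh) => [|u v|c v vc].
  - exact: brack0r.
  - by rewrite brackDr => -> ->; rewrite addr0.
  have [c0|c0] := eqVneq c 0; first by rewrite c0 in vc; apply: Ccomm.
  have [v0|v0] := eqVneq v 0; first by rewrite v0 brack0r.
  by rewrite (alE c) // al_root ?scale0r //; split=> //; exists v.
exists [seq c <- R0 | c != 0], (fun c => p c y); split.
  by move=> c; rewrite mem_filter => /andP[-> _].
rewrite {1}[y]pE (bigID (fun c => c == 0)) /= big1 ?add0r ?big_filter // => c /eqP->.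
by rewrite -y0E.
Qed.

End Principal.

Lemma seq_argmin (T : eqType) (F : T -> rat) (r : seq T) (P : T -> Prop) :
  (exists c, c \in r /\ P c) ->
  exists c, P c /\ forall d, d \in r -> P d -> F c <= F d.
Proof.
elim: r => [[c []]//|a r IHr] [c [cr Pc]].
have [[d [dr Pd]]|nr] := pselect (exists d, d \in r /\ P d).
  have [b [Pb minb]] := IHr (ex_intro _ d (conj dr Pd)).
  have [Pa|nPa] := pselect (P a); last first.
    by exists b; split=> // x; rewrite inE => /predU1P[->//|xr]; apply: minb.
  have [le_ab|/ltW le_ba] := leP (F a) (F b); [exists a | exists b]; split=> // x;
    rewrite inE => /predU1P[->//|xr] Px; last exact: minb.
  exact: le_trans le_ab (minb x xr Px).
exists c; split=> // d dr Pd; have only x : x \in a :: r -> P x -> x = a.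
  by rewrite inE => /predU1P[//|xr] Px; case: nr; exists x.
by rewrite (only _ cr Pc) (only _ dr Pd).
Qed.

(** * Derivations into an abelian radical *)

Section AbelianRadical.

Context {K : closedFieldType}.
Hypothesis char0 : [pchar K] =i pred0.
Variables (g s : lieAlgType K) (pi : 'Hom(g, s)) (A : {vspace g}).
Hypothesis ss : lie_semisimple s.
Hypothesis pi_surj : limg pi = fullv.
Hypothesis pi_ker : lker pi = A.
Hypothesis pi_hom : forall x y, pi [lie x, y] = [lie pi x, pi y].
Hypothesis abA : forall x y, x \in A -> y \in A -> [lie x, y] = 0.

Lemma mem_kernel x : x \in A <-> pi x = 0.
Proof. by rewrite -pi_ker memv_ker; split=> [/eqP|->]. Qed.

Lemma kernel_ideal x y : y \in A -> [lie x, y] \in A.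
Proof. by move=> /mem_kernel y0; apply/mem_kernel; rewrite pi_hom y0 brack0r. Qed.

Lemma kernel_ideall x y : x \in A -> [lie x, y] \in A.
Proof. by move=> xA; rewrite brackC memvN kernel_ideal. Qed.

Lemma act_kernel_eq u u' v : pi u = pi u' -> v \in A -> [lie u, v] = [lie u', v].
Proof.
move=> uu' vA; apply/eqP; rewrite -subr_eq0 -brackBl abA //.
by apply/mem_kernel; rewrite lfunB uu' subrr.
Qed.

Lemma hom_rep : exists rho : 'Hom(g, 'End('End(g))), lie_rep rho /\
  forall x (F : 'End(g)) v, rho x F v = [lie x, F v] - F [lie x, v].
Proof.
have op x : exists a : 'End('End(g)), forall F : 'End(g), a F = ((ad x \o F) - (F \o ad x))%VF.
  exact: commutator_op.
have [a aE] := choice op.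
have aEv x (F : 'End(g)) v : a x F v = [lie x, F v] - F [lie x, v].
  by rewrite aE add_lfunE opp_lfunE !comp_lfunE !adE.
have [|rho rhoE] := @lfun_of_linear K g 'End('End(g)) a.
  move=> c x y; apply/lfunP=> F; apply/lfunP=> v.
  rewrite add_lfunE scale_lfunE (add_lfunE (c *: a x F)) scale_lfunE !aEv.
  by rewrite !brackDl !brackZl lfunD lfunZ opprD addrACA scalerBr.
have {}rhoE x (F : 'End(g)) v : rho x F v = [lie x, F v] - F [lie x, v] by rewrite rhoE aEv.
exists rho; split=> // x y F.
apply/lfunP=> v; rewrite add_lfunE opp_lfunE !rhoE !brackBr !(brackJl x y) lfunB.
have subrE (t1 t2 t3 t4 : g) : t1 - t2 - (t3 - t4) = t1 + t4 - (t2 + t3).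
  by rewrite opprB addrACA -opprD.
rewrite [RHS]subrE addrA subrK [X in _ = _ - X]addrC [X in _ = _ - X]addrA subrK.
exact: subr_ACA.
Qed.

(** Correct the linear projection [P0] onto [M]: the commutators [[ad x, P0]] form a
cocycle with values in the endomorphisms that map [A] into [M] and kill [M], taken
modulo those that vanish on [A]. *)
Lemma equivariant_projection (M : {vspace g}) : (M <= A)%VS -> lie_ideal M ->
  exists P : 'End(g), [/\ forall v, v \in A -> P v \in M, forall v, v \in M -> P v = v &
    forall x v, v \in A -> P [lie x, v] = [lie x, P v]].
Proof.
move=> /subvP MsubA iM; have [rho [rep rhoE]] := hom_rep; pose P0 := projv M.
pose inU (F : 'End(g)) := (forall v, v \in A -> F v \in M) /\ (forall v, v \in M -> F v = 0).
have memU F : F \in vspace_of inU <-> inU F.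
  apply: mem_vspace_of => [|a u v [uA uM] [vA vM]].
    by split=> v _; rewrite zero_lfunE ?mem0v.
  split=> w wP; rewrite add_lfunE scale_lfunE; first by rewrite memvD ?memvZ ?uA ?vA.
  by rewrite uM ?vM // scaler0 addr0.
pose inU' (F : 'End(g)) := forall v, v \in A -> F v = 0.
have memU' F : F \in vspace_of inU' <-> inU' F.
  apply: mem_vspace_of => [v _|a u v uA vA w wA]; first by rewrite zero_lfunE.
  by rewrite add_lfunE scale_lfunE uA ?vA // scaler0 addr0.
have [f fE] : exists f : 'Hom(g, 'End(g)), forall x, f x = rho x P0.
  apply: lfun_of_linear => a x y.
  by rewrite lfunD lfunZ add_lfunE scale_lfunE.
have [|||||||F [/memU[FA FM] FE]] := whitehead_subquotient char0 ss (U' := vspace_of inU')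
  (U := vspace_of inU) (f := f) pi_surj pi_hom rep.
- apply/subvP=> F /memU' F0; apply/memU; split=> v; last by move/MsubA/F0.
  by move/F0->; rewrite mem0v.
- move=> x F /memU[FA FM]; apply/memU; split=> v vP; rewrite rhoE.
    by rewrite memvB ?iM ?FA ?kernel_ideal.
  by rewrite !FM ?iM // brack0r subrr.
- by move=> x F /memU' F0; apply/memU' => v vA; rewrite rhoE !F0 ?kernel_ideal // brack0r subrr.
- move=> x F /mem_kernel xA /memU[FA FM]; apply/memU' => v vA; rewrite rhoE !abA ?lfun0 ?subrr //.
  exact/MsubA/FA.
- move=> x; apply/memU; rewrite fE; split=> v vP; rewrite rhoE.
    by rewrite memvB ?iM ?memv_proj.
  by rewrite !projv_id ?iM // subrr.
- move=> x /mem_kernel xA; apply/memU' => v vA; rewrite fE rhoE !abA ?lfun0 ?subrr //.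
  exact/MsubA/memv_proj.
- by move=> x y; rewrite !fE rep subrr mem0v.
exists (P0 - F); split=> [v vA|v vM|x v vA]; rewrite !(add_lfunE, opp_lfunE).
- by rewrite memvB ?memv_proj ?FA.
- by rewrite projv_id // FM // subr0.
have /memU'/(_ _ vA) := FE x; rewrite add_lfunE opp_lfunE fE !rhoE subr_ACA => /eqP.
by rewrite subr_eq0 brackBr => /eqP.
Qed.

(** The commutators of a linear projection onto [A] form a cocycle with values in the
endomorphisms that map [g] into [A] and kill [A], modulo [ad A]; the latter
must be divided out for [A] to act trivially. *)
Lemma levi_projection : exists F : 'End(g), [/\ forall v, F v \in A,
  forall v, v \in A -> F v = v &
  forall x, exists2 a, a \in A & forall v, [lie x, F v] - F [lie x, v] = [lie a, v]].
Proof.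
have [rho [rep rhoE]] := hom_rep; pose P0 := projv A.
pose inU (F : 'End(g)) := (forall v, F v \in A) /\ (forall v, v \in A -> F v = 0).
have memU F : F \in vspace_of inU <-> inU F.
  apply: mem_vspace_of => [|a u v [ug uA] [vg vA]].
    by split=> v => [|_]; rewrite zero_lfunE ?mem0v.
  split=> w => [|wP]; rewrite add_lfunE scale_lfunE; first by rewrite memvD ?memvZ.
  by rewrite uA ?vA // scaler0 addr0.
pose U' := (@adr K g @: A)%VS.
have memU' (F : 'End(g)) a : a \in A -> (forall v, F v = [lie a, v]) -> F \in U'.
  move=> aA FE; suff -> : F = adr a by apply: memv_img.
  by apply/lfunP=> v; rewrite FE adrE.
have [f fE] : exists f : 'Hom(g, 'End(g)), forall x, f x = rho x P0.
  apply: lfun_of_linear => a x y.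
  by rewrite lfunD lfunZ add_lfunE scale_lfunE.
have [|||||||F [/memU[Fg FA] FE]] := whitehead_subquotient char0 ss (U' := U')
  (U := vspace_of inU) (f := f) pi_surj pi_hom rep.
- apply/subvP=> _ /memv_imgP[a aA ->]; apply/memU; split=> [v|v vA]; rewrite adrE.
    exact: kernel_ideall.
  exact: abA.
- move=> x F /memU[Fg FA]; apply/memU; split=> [v|v vA]; rewrite rhoE.
    by rewrite memvB ?kernel_ideal.
  by rewrite !FA ?kernel_ideal // brack0r subrr.
- move=> x _ /memv_imgP[a aA ->]; apply: (memU' _ [lie x, a]) => [|v]; first exact: kernel_ideal.
  by rewrite rhoE !adrE brackJl.
- move=> x F /mem_kernel xA /memU[Fg FA]; apply: (memU' _ 0) => [|v]; first exact: mem0v.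
  by rewrite rhoE abA // FA ?kernel_ideall // subrr brack0l.
- move=> x; apply/memU; rewrite fE; split=> [v|v vA]; rewrite rhoE.
    by rewrite memvB ?kernel_ideal ?memv_proj.
  by rewrite !projv_id ?kernel_ideal // subrr.
- move=> x /mem_kernel xA; apply: (memU' _ (- x)) => [|v]; first by rewrite memvN.
  by rewrite fE rhoE abA ?memv_proj // projv_id ?kernel_ideall // sub0r brackNl.
- by move=> x y; rewrite !fE rep subrr mem0v.
exists (P0 - F); split=> [v|v vA|x]; rewrite ?(add_lfunE, opp_lfunE).
- by rewrite memvB ?memv_proj ?Fg.
- by rewrite projv_id // FA // subr0.
have /memv_imgP[a aA aE] := FE x; exists a => // v.
have := congr1 (fun G : 'End(g) => G v) aE; rewrite adrE => <-.
by rewrite !(add_lfunE, opp_lfunE) fE !rhoE subr_ACA brackBr.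
Qed.

(** [L] is the centralizer of the projection [F] of [levi_projection].  It meets [A]
in central elements only, so it is a Levi complement up to the centre.  An
equivariant projection [Q] onto the central elements of [A] makes [Q o F] vanish on
[[L, L]], while it is the identity on the centre. *)
Lemma levi_supplement : exists L : g -> Prop,
  (forall y, exists2 a, a \in A & L (y + a)) /\
  (forall x y, L x -> L y -> [lie x, y] \in A -> [lie x, y] = 0).
Proof.
have [F [Fg FA FE]] := levi_projection.
pose inZ z := z \in A /\ forall v, [lie v, z] = 0.
have memZ z : z \in vspace_of inZ <-> inZ z.
  apply: mem_vspace_of => [|a u v [uA uZ] [vA vZ]].
    by split=> [|v]; [apply: mem0v | apply: brack0r].
  split=> [|w]; first by rewrite memvD ?memvZ.
  by rewrite brackDr brackZr uZ vZ scaler0 addr0.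
have [||Q [QA QZ Qeq]] := @equivariant_projection (vspace_of inZ).
- by apply/subvP=> z /memZ[].
- by move=> x z /memZ[zA zZ]; rewrite zZ mem0v.
exists (fun y => forall v, [lie y, F v] = F [lie y, v]); split=> [y|x y Lx Ly xyA].
  have [a aA aE] := FE y; exists a => // v; rewrite !brackDl lfunD.
  rewrite [F [lie a, v]]FA ?kernel_ideall // (abA aA (Fg v)) addr0 -aE.
  by rewrite addrC subrK.
have Lxy v : [lie [lie x, y], F v] = F [lie [lie x, y], v].
  by rewrite !brackJl lfunB -!Lx -!Ly -!Lx.
have Zxy : [lie x, y] \in vspace_of inZ.
  apply/memZ; split=> // v; rewrite brackC; apply/eqP; rewrite oppr_eq0; apply/eqP.
  by rewrite -(FA _ (kernel_ideall v xyA)) -Lxy (abA xyA (Fg v)).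
rewrite -(QZ _ Zxy) -[in LHS](FA _ xyA) -Lx Qeq //.
by have /memZ[_ ->] := QA _ (Fg y).
Qed.

Lemma geig_shift_on (h : g) (G : 'End(g)) c d v :
  (forall w, w \in A -> [lie h, G w] = G [lie h, w] + c *: G w) ->
  v \in A -> geig (ad h) d v -> geig (ad h) (d + c) (G v).
Proof.
move=> hG vA [n E]; exists n; rewrite -[RHS](lfun0 G) -E.
suff [_ ->] : iter n (shift (ad h) d) v \in A /\
  iter n (shift (ad h) (d + c)) (G v) = G (iter n (shift (ad h) d) v) by [].
elim: n {E} => //= n [wA ->]; rewrite !shiftE !adE; split.
  by rewrite memvB ?memvZ ?kernel_ideal.
by rewrite hG // lfunB lfunZ scalerDl opprD addrACA subrr addr0.
Qed.

Lemma geig_root (h y : g) c d v : pi y \in eigsp (pi h) c ->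
  v \in A -> geig (ad h) d v -> geig (ad h) (d + c) [lie y, v].
Proof.
rewrite mem_eigsp -pi_hom -lfunZ => /eqP hy vA hv; rewrite -adE.
apply: geig_shift_on vA hv => w wA; rewrite !adE brackJ addrC; congr (_ + _).
by rewrite (act_kernel_eq hy wA) brackZl.
Qed.

Variable D : 'End(g).
Hypothesis derD : is_derivation D.
Hypothesis D_in_kernel : forall x, D x \in A.
Hypothesis D_almost_inner : forall x, exists y, D x = [lie y, x].

Lemma D_equivariant x v : v \in A -> D [lie x, v] = [lie x, D v].
Proof. by move=> vA; rewrite derD (abA (D_in_kernel x)) // add0r. Qed.

Lemma geig_comm h (G : 'End(g)) d v :
  (forall w, w \in A -> G [lie h, w] = [lie h, G w]) ->
  v \in A -> geig (ad h) d v -> geig (ad h) d (G v).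
Proof.
move=> hG vA hv; rewrite -[d]addr0; apply: geig_shift_on vA hv => w wA.
by rewrite hG // scale0r addr0.
Qed.

(** Compare the weight-[m] components of the two sides of
[D b = [y1, P b] + [x, P (a1 - a0)]], where [m] is the lowest weight of [D(A)]. *)
Theorem almost_inner_vanishes v : v \in A -> D v = 0.
Proof.
pose M := (D @: A)%VS.
have MsubA w : w \in M -> w \in A by move=> /memv_imgP[u _ ->]; apply: D_in_kernel.
have iM : lie_ideal M.
  move=> x _ /memv_imgP[u uA ->]; rewrite -D_equivariant //.
  by rewrite memv_img ?kernel_ideal.
have [|P [PinM PM Peq]] := @equivariant_projection M _ iM; first exact/subvP.
have [hs [F [r [e [ssh FL eP prin]]]]] := principal_element char0 ss.
have [L [Lsup Lbr]] := levi_supplement.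
have lift y : exists x, pi x = y /\ L x.
  have /memv_imgP[x _ ->] : y \in limg pi by rewrite pi_surj memvf.
  have [a /mem_kernel a0 La] := Lsup x; exists (x + a); split=> //.
  by rewrite lfunD a0 addr0.
have [sg sgP] := choice lift; have sgK y : pi (sg y) = y by have [] := sgP y.
have [h [hE _]] := lift hs; have [x [xE Lx]] := lift (\sum_(c <- r) e c).
have [R0 [p [_ gp pE p1 p0]]] := geig_projectors (ad h).
have actE y (rr : seq K) (w : K -> s) u : pi y = \sum_(c <- rr) w c -> u \in A ->
    [lie y, u] = \sum_(c <- rr) [lie sg (w c), u].
  move=> yE uA; rewrite -brack_suml; apply: act_kernel_eq => //.
  by rewrite yE lfun_sum; apply: eq_bigr => c _; rewrite sgK.
have stM w : w \in M -> ad h w \in M by rewrite adE; apply: iM.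
have stA w : w \in A -> ad h w \in A by rewrite adE; apply: kernel_ideal.
suff M0 : M = 0%VS.
  by move=> vA; apply/eqP; rewrite -memv0 -M0 memv_img.
apply: contrapT => /eqP M0.
pose good c := exists w, [/\ w \in M, w != 0 & geig (ad h) c w].
have goodR c w : w \in M -> w != 0 -> geig (ad h) c w -> c \in R0.
  move=> wM w0 hw; apply: contraNT w0 => cR; rewrite [w]pE big_seq big1 // => d dR.
  by apply: (p0 c) => //; apply: contraNneq cR => ->.
(* [m] is a lowest weight of [h] on [M] *)
have [m [[w [wM w0 hw]] minm]] : exists m, good m /\ forall d, d \in R0 -> good d -> F m <= F d.
  apply: seq_argmin; apply: contrapT => nex; case/negP: M0.
  rewrite -subv0; apply/subvP=> u uM; rewrite memv0.
  apply/eqP; apply: (@geig_ind K g M (ad h) (fun u => u = 0) stM) uM => // [a b -> ->|c b bM hb].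
    by rewrite addr0.
  apply: contrapT => /eqP b0; apply: nex; exists c.
  by split; [apply: (goodR _ b) | exists b].
case/negP: w0; rewrite -(p1 _ _ hw); have /memv_imgP[u uA ->] := wM; apply/eqP.
apply: (@geig_ind K g A (ad h) (fun u => p m (D u) = 0) stA) uA => [|a b|c b bA hb].
- by rewrite !lfun0.
- by rewrite !lfunD => -> ->; rewrite addr0.
have hDb : geig (ad h) c (D b) by apply: geig_comm => // z zA; apply: D_equivariant.
have [cm|cm] := eqVneq c m; last by apply: p0 hDb.
rewrite {c}cm in hb hDb.
have [y0 Dx] := D_almost_inner x; have [y1 Dxb] := D_almost_inner (x + b).
have [a0 a0A La0] := Lsup y0; have [a1 a1A La1] := Lsup y1.
have xb_A : [lie y1, b] \in A by apply: kernel_ideal.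
have comm y a : a \in A -> L (y + a) -> [lie y, x] \in A -> [lie y + a, x] = 0.
  move=> aA La yx; apply: Lbr => //; rewrite brackDl; apply: memvD => //; exact: kernel_ideall.
have yx0 : [lie y0, x] \in A by rewrite -Dx.
have yx1 : [lie y1, x] \in A.
  by have := D_in_kernel (x + b); rewrite Dxb brackDr => /memvB/(_ xb_A); rewrite addrK.
have z0 := comm _ _ a0A La0 yx0; have z1 := comm _ _ a1A La1 yx1.
(* [a0] and [a1] correct [y0] and [y1] to elements of [L], whose brackets with [x]
vanish as soon as they fall into [A] *)
have Db : D b = [lie y1, b] + [lie x, a1 - a0].
  have -> : D b = D (x + b) - D x by rewrite -lfunB [x + b]addrC addrK.
  rewrite Dxb Dx brackDr brackBr (brackC x a1) (brackC x a0) opprK.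
  move/eqP: z0; rewrite brackDl addr_eq0 => /eqP->.
  move/eqP: z1; rewrite brackDl addr_eq0 => /eqP->.
  by rewrite opprK addrAC addrC addrA.
have PbM : P b \in M by apply: PinM.
have DbM : D b \in M by apply: memv_img.
have DbE : D b = [lie y1, P b] + [lie x, P (a1 - a0)].
  by rewrite -[LHS](PM _ DbM) Db lfunD !Peq // memvB.
rewrite DbE lfunD.
have hPb : geig (ad h) m (P b) by apply: geig_comm => // z zA; apply: Peq.
have xy1 : [lie \sum_(c <- r) e c, pi y1] = 0.
  rewrite -xE -pi_hom; have := congr1 pi z1; rewrite brackDl lfunD lfun0.
  have /mem_kernel-> : [lie a1, x] \in A by apply: kernel_ideall.
  by rewrite addr0 => y10; rewrite brackC lfunN y10 oppr0.
(* [y1] centralizes [x] modulo [A], so it only shifts weights by nonzero amounts *)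
have [r' [w' [w'P y1E]]] := prin _ xy1.
rewrite (actE _ _ _ _ y1E (MsubA _ PbM)) lfun_sum big_seq big1 ?add0r => [|c cr']; last first.
  have [cn0 w'c] := w'P c cr'.
  apply: (p0 (m + c)); first by rewrite -subr_eq0 addrAC subrr add0r.
  by apply: geig_root => //; [rewrite hE sgK | apply: MsubA].
have : P (a1 - a0) \in M by apply/PinM/memvB.
(* [x] raises weights, so no weight of [M] is raised to the lowest one *)
move: (P (a1 - a0)); apply: (@geig_ind K g M (ad h) (fun u => p m [lie x, u] = 0) stM).
- by rewrite brack0r lfun0.
- by move=> u1 u2; rewrite brackDr lfunD => -> ->; rewrite addr0.
move=> c u1 u1M hu; have [->|u10] := eqVneq u1 0; first by rewrite brack0r lfun0.
have le_mc : F m <= F c by apply: minm; [apply: (goodR _ u1) | exists u1].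
rewrite (actE _ _ _ _ xE (MsubA _ u1M)) lfun_sum big_seq big1 // => d dr.
have [ed Fd] := eP d dr; apply: (p0 (c + d)).
  apply: contraTneq le_mc => <-; rewrite (QlinearD char0) // -ltNge ltrDl.
  exact: Fd.
by apply: geig_root => //; [rewrite hE sgK | apply: MsubA].
Qed.

End AbelianRadical.

(** * Almost inner derivations are inner *)

Theorem theorem5p3 (K : closedFieldType) (g : lieAlgType K) :
  [pchar K]%R =i pred0 -> lie_abelian (radical g) -> AID g = Inn g.
Proof.
move=> char0 abR; have radR := radicalP g; have [iR _ _] := radR.
have [s [pi [pi_surj pi_ker pi_hom]]] := quotient_exists iR.
have ss := radical_quotient_semisimple radR pi_surj pi_ker pi_hom.
have abA x y : x \in radical g -> y \in radical g -> [lie x, y] = 0.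
  by move=> xR yR; apply/eqP; rewrite -memv0 -abR memv_brack.
have kerP x : pi x = 0 -> x \in radical g by rewrite -pi_ker memv_ker => ->.
rewrite predeqE => D; split=> [[derD D_almost_inner]|[x _ <-]]; last first.
  split=> [y z|y]; first by rewrite !adE brackJ.
  by exists x; rewrite adE.
have adrR x w : w \in radical g -> adr x w \in radical g by move=> wR; rewrite adrE iR.
have [||||||u [_ uE]] := whitehead_subquotient char0 ss (U' := radical g)
  (U := fullv) (f := D) pi_surj pi_hom (@adr_rep K g) (subvf _).
- by move=> *; apply: memvf.
- exact: adrR.
- by move=> x w /kerP xR _; rewrite adrE brackC memvN iR.
- by move=> *; apply: memvf.
- by move=> x /kerP xR; have [y ->] := D_almost_inner x; apply: iR.
- by move=> x y; rewrite !adrE derD (brackC (D x)) [- _ + _]addrC subrr mem0v.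
(* [D1] differs from [D] by an inner derivation and takes its values in the radical *)
pose D1 := (D + ad u)%R.
have D1E x : D1 x = D x + [lie u, x] by rewrite add_lfunE adE.
have derD1 : is_derivation D1.
  move=> x y; rewrite !D1E derD brackJ brackDl brackDr addrACA; congr (_ + _).
have D1R x : D1 x \in radical g by rewrite D1E brackC -adrE.
have inD1 x : exists y, D1 x = [lie y, x].
  by have [y yE] := D_almost_inner x; exists (y + u); rewrite D1E yE brackDl.
have D10 := almost_inner_vanishes char0 ss pi_surj pi_ker pi_hom abA derD1 D1R inD1.
have [||||||v [_ vE]] := whitehead_subquotient char0 ss (U' := 0%VS)
  (U := radical g) (f := D1) pi_surj pi_hom (@adr_rep K g) (sub0v _).
- exact: adrR.
- by move=> x w; rewrite !memv0 => /eqP->; rewrite lfun0.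
- by move=> x w /kerP xR wR; rewrite adrE abA // mem0v.
- exact: D1R.
- by move=> x /kerP xR; rewrite D10 // mem0v.
- by move=> x y; rewrite !adrE derD1 (brackC (D1 x)) [- _ + _]addrC subrr mem0v.
exists (- v - u) => //; apply/lfunP=> x.
have := vE x; rewrite memv0 subr_eq0 adrE D1E => /eqP E.
by rewrite adE brackBl brackNl -brackC -E addrK.
Qed.
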